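(* There is an efficient (polynomial-time, given an independence oracle for $M$) combinatorial algorithm which, given an instance $((X,d),w,M,m)$ of Robust Matroid Center and a number $r\in\mathbb{R}_{\ge0}$, has the following guarantee: if there exists $F\in\mathcal{I}$ with $w(B(F,r))\ge m$, then the algorithm returns a set $R\in\mathcal{I}$ with $w(B(R,5r))\ge m$.
   Context: For a finite metric space $(X,d)$, $u\in X$ and $r\ge 0$, let $B(u,r)=\{v\in X: d(u,v)\le r\}$, and for $U\subseteq X$ let $B(U,r)=\bigcup_{u\in U}B(u,r)$. For $w\colon X\to\mathbb{R}_{\ge 0}$ and $U\subseteq X$, $w(U)=\sum_{u\in U}w(u)$. An instance of Robust Matroid Center consists of a finite metric space $(X,d)$, weights $w\colon X\to\mathbb{R}_{\ge0}$, a matroid $M=(X,\mathcal{I})$ given by an independence oracle, and $m\in\mathbb{R}_{\ge0}$; a solution of radius $r$ is a set $C\in\mathcal{I}$ with $w(B(C,r))\ge m$. *)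

(* Defs.v *)
From HB Require Import structures.
From mathcomp Require Import all_boot all_order all_algebra.
From mathcomp Require Import reals topology_structure uniform_structure.
From mathcomp Require Import pseudometric_structure metric_structure.

Set Implicit Arguments.
Unset Strict Implicit.
Unset Printing Implicit Defensive.

Import Order.TTheory GRing.Theory Num.Theory.

Local Open Scope ring_scope.

#[short(type="finMetricType")]
HB.structure Definition FinMetric (K : numDomainType) :=
  { X of Metric K X & Finite X }.

Section Balls.
Context {R : realType} {X : finMetricType R}.

Definition cball (u : X) (r : R) : {set X} := [set v | mdist u v <= r].

Definition cballU (U : {set X}) (r : R) : {set X} := \bigcup_(u in U) cball u r.

Definition weight (w : X -> R) (U : {set X}) : R := \sum_(u in U) w u.

End Balls.

Record matroid (T : finType) := Matroid {
  indep : {set {set T}};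
  indep0 : set0 \in indep;
  indepS : forall A B : {set T}, A \subset B -> B \in indep -> A \in indep;
  indep_augment : forall A B : {set T}, A \in indep -> B \in indep ->
    (#|A| < #|B|)%N -> exists2 x, x \in B :\: A & x |: A \in indep
}.

Record rmc_instance (R : realType) := RmcInstance {
  points : finMetricType R;
  wt : points -> R;
  wt_ge0 : forall x, 0 <= wt x;
  mtr : matroid points;
  target : R;
  target_ge0 : 0 <= target
}.

Definition rmc_solution (R : realType) (A : rmc_instance R) (r : R)
    (C : {set points A}) : Prop :=
  C \in indep (mtr A) /\ target A <= weight (@wt R A) (cballU C r).

(* The model of computation is a random access machine with two kinds of
   memory, natural numbers and reals, programmed in a structured language.
   Memory is organised in arrays: NGet a e and RGet a e denote the entry of
   index e of the array of name a, the name being fixed by the program; a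
   scalar variable is the entry 0 of an array.

   Numbers (of both kinds) can only be added, subtracted and compared. There is
   no multiplication, so in t steps the bit length of a number grows by O(t) and
   unit cost is polynomially related to bit cost; the reals can moreover not be
   rounded, so no computation can be hidden in their digits.

   The points of the instance are numbered 0, ..., n-1, following enum. The
   matroid is available only through the test BIndep a, a query of the
   independence oracle about the set of the points i whose entry in the natural
   number array a is nonzero. *)
Inductive nexp : Type :=
| NConst of nat
| NPoints                      (* the number n of points *)
| NGet of nat & nexp
| NAdd of nexp & nexp
| NSub of nexp & nexp.         (* truncated *)

Inductive rexp : Type :=
| RZero
| RDist of nexp & nexp
| RWeight of nexp
| RTarget
| RRadius
| RGet of nat & nexp
| RAdd of rexp & rexp
| RSub of rexp & rexp.

Inductive bexp : Type :=
| BLeN of nexp & nexp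
| BLeR of rexp & rexp
| BIndep of nat
| BNot of bexp
| BAnd of bexp & bexp.

Inductive cmd : Type :=
| CSkip
| CSetN of nat & nexp & nexp   (* CSetN a i e : a[i] := e *)
| CSetR of nat & nexp & rexp
| CSeq of cmd & cmd
| CIf of bexp & cmd & cmd
| CWhile of bexp & cmd.

Section Semantics.
Context {R : realType} (A : rmc_instance R) (r : R).

Local Notation X := (points A).

Record state := State {
  nmem : nat -> nat -> nat;
  rmem : nat -> nat -> R
}.

Definition init_state : state := State (fun _ _ => 0%N) (fun _ _ => 0).

Definition update (T : Type) (f : nat -> nat -> T) (a i : nat) (v : T) :
    nat -> nat -> T :=
  fun b j => if (b == a) && (j == i) then v else f b j.

Definition decode_set (f : nat -> nat) : {set X} :=
  [set x | f (enum_rank x) != 0%N].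

(* Numbers that are not the number of a point yield 0. *)
Definition dist_input (i j : nat) : R :=
  match onth (enum X) i, onth (enum X) j with
  | Some x, Some y => mdist x y
  | _, _ => 0
  end.

Definition weight_input (i : nat) : R :=
  if onth (enum X) i is Some x then wt x else 0.

Fixpoint neval (s : state) (e : nexp) : nat :=
  match e with
  | NConst k => k
  | NPoints => #|X|
  | NGet a e1 => nmem s a (neval s e1)
  | NAdd e1 e2 => (neval s e1 + neval s e2)%N
  | NSub e1 e2 => (neval s e1 - neval s e2)%N
  end.

Fixpoint reval (s : state) (e : rexp) : R :=
  match e with
  | RZero => 0
  | RDist e1 e2 => dist_input (neval s e1) (neval s e2)
  | RWeight e1 => weight_input (neval s e1)
  | RTarget => target A
  | RRadius => r
  | RGet a e1 => rmem s a (neval s e1)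
  | RAdd e1 e2 => reval s e1 + reval s e2
  | RSub e1 e2 => reval s e1 - reval s e2
  end.

Fixpoint beval (s : state) (b : bexp) : bool :=
  match b with
  | BLeN e1 e2 => (neval s e1 <= neval s e2)%N
  | BLeR e1 e2 => reval s e1 <= reval s e2
  | BIndep a => decode_set (nmem s a) \in indep (mtr A)
  | BNot b1 => ~~ beval s b1
  | BAnd b1 b2 => beval s b1 && beval s b2
  end.

(* exec c s t s' : started in s, the program c halts in s' after t steps. A step
   is an assignment or a test; since the expressions in it are fixed by the
   program, it amounts to a bounded number of operations and oracle queries. *)
Inductive exec : cmd -> state -> nat -> state -> Prop :=
| ExSkip s : exec CSkip s 1 s
| ExSetN s a i e :
    exec (CSetN a i e) s 1
      (State (update (nmem s) a (neval s i) (neval s e)) (rmem s))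
| ExSetR s a i e :
    exec (CSetR a i e) s 1
      (State (nmem s) (update (rmem s) a (neval s i) (reval s e)))
| ExSeq c1 c2 s s1 s2 t1 t2 :
    exec c1 s t1 s1 -> exec c2 s1 t2 s2 -> exec (CSeq c1 c2) s (t1 + t2)%N s2
| ExIf b c1 c2 s s1 t :
    exec (if beval s b then c1 else c2) s t s1 -> exec (CIf b c1 c2) s t.+1 s1
| ExWhileF b c s : ~~ beval s b -> exec (CWhile b c) s 1 s
| ExWhileT b c s s1 s2 t1 t2 :
    beval s b -> exec c s t1 s1 -> exec (CWhile b c) s1 t2 s2 ->
    exec (CWhile b c) s (t1 + t2).+1 s2.

Lemma exec_det c s t1 s1 t2 s2 :
  exec c s t1 s1 -> exec c s t2 s2 -> t1 = t2 /\ s1 = s2.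
Proof.
move=> h; elim: h t2 s2 => {c s t1 s1}.
- by move=> s t2 s2 h; inversion h.
- by move=> s a i e t2 s2 h; inversion h.
- by move=> s a i e t2 s2 h; inversion h.
- move=> c1 c2 s s1 s2 t1 t2 _ IH1 _ IH2 t s' h.
  inversion h as [| | |? ? ? ? ? ? ? h1 h2| | |]; subst.
  have [? ?] := IH1 _ _ h1; subst.
  by have [-> ->] := IH2 _ _ h2.
- move=> b c1 c2 s s1 t _ IH t2 s2 h.
  inversion h as [| | | |? ? ? ? ? ? h1| |]; subst.
  by have [-> ->] := IH _ _ h1.
- move=> b c s nb t2 s2 h.
  by inversion h as [| | | | | |? ? ? ? ? ? ? sb]; subst => //; rewrite sb in nb.
- move=> b c s s1 s2 t1 t2 sb _ IH1 _ IH2 t s' h.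
  inversion h as [| | | | |? ? ? nb|? ? ? ? ? ? ? ? h1 h2]; subst.
    by rewrite sb in nb.
  have [? ?] := IH1 _ _ h1; subst.
  by have [-> ->] := IH2 _ _ h2.
Qed.

(* The set returned by a program is read off the natural number array 0. *)
Definition output (s : state) : {set X} := decode_set (nmem s 0%N).

End Semantics.

(* Main.v *)
(* Call a set [C] of centers matchable if its members can be assigned distinct points
   at distance at most [2r], the assigned points being independent in the matroid.
   The algorithm builds such a set greedily: among the points not yet considered it
   takes the point [u] whose ball of radius [r] contains the largest uncovered
   weight, accepts [u] if the set stays matchable, and then declares the ball of
   radius [3r] around [u] covered. The points finally assigned to the centers are
   independent, and their balls of radius [5r] contain everything covered.

   Matchable sets are the independent sets of a matroid (Rado), and acceptance is
   decided by an augmenting path. A shortest path is traversed from its end, one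
   reassignment at a time, so that after each reassignment the assigned points are
   independent and the path has become shorter by one edge.

   To compare with an independent set [F], call an accepted [u] a hit if the part of
   its [r]-ball uncovered at that time meets the [r]-balls of [F]. Distinct hits can
   be assigned distinct points of [F] within [2r], whose [r]-balls are covered. Hits
   together with the points of [F] with uncovered weight therefore form a matchable
   set; the matroid property lets one charge the latter injectively to accepted
   points that are not hits and were chosen when their competitor was eligible. *)
Require Import Defs.
From mathcomp Require Import all_boot all_order all_algebra.
From mathcomp Require Import reals metric_structure.

Set Implicit Arguments.
Unset Strict Implicit.
Unset Printing Implicit Defensive.

Import Order.TTheory GRing.Theory Num.Theory.

(** * Matroid exchange *)

Section Exchange.
Context {T : finType} (M : matroid T).
Local Notation I := (indep M).
Implicit Types (A B V J : {set T}) (v w : T).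

Lemma indep_extend A B : A \in I -> B \in I -> #|A| <= #|B| ->
  exists A', [/\ A' \in I, A \subset A', A' \subset A :|: B & #|A'| = #|B|].
Proof.
move: {2}(#|B| - #|A|) (erefl (#|B| - #|A|)) => k.
elim: k A => [|k IH] A Ek AI BI le.
  exists A; split=> //; first exact: subsetUl.
  by apply/eqP; rewrite eqn_leq le -subn_eq0 Ek.
have lt : #|A| < #|B| by rewrite -subn_gt0 Ek.
have [x /setDP[xB xA] xI] := indep_augment AI BI lt.
have cx : #|x |: A| = #|A|.+1 by rewrite cardsU1 xA.
have [||A' [A'I sA sA' cA']] := IH (x |: A) _ xI BI.
- by rewrite cx subnS Ek.
- by rewrite cx.
exists A'; split=> //; first exact: subset_trans (subsetUr _ _) sA.
apply: subset_trans sA' _.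
by rewrite !subUset sub1set in_setU xB orbT subsetUl subsetUr.
Qed.

(** Only [V :\ w] must avoid [v], so the trivial exchange [v = w] is an edge: a center may take over
    the point of another. *)
Definition edge V w v := (v \notin V :\ w) && (v |: V :\ w \in I).
Definition addable V v := (v \notin V) && (v |: V \in I).

Lemma addable_indep V v : addable V v -> V \in I.
Proof. by case/andP=> _; apply: indepS; apply: subsetUr. Qed.

Lemma edge_self V w : V \in I -> w \in V -> edge V w w.
Proof. by move=> VI wV; rewrite /edge setD1K // VI !inE eqxx. Qed.

(** For [v' != w], augmenting [v' |: V :\ w] from the larger [v |: V] can only bring in [v]:
    bringing back [w] would make [v'] addable to [V]. *)
Lemma addable_swap V v w v' : addable V v -> w \in V -> ~~ addable V v' ->
  edge V w v' -> addable (v |: V :\ w) v'.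
Proof.
move=> fv wV nf' /andP[v'V v'I].
have v'v : v' != v by apply: contraNneq nf' => ->.
rewrite /addable in_setU1 (negPf v'v) v'V /=.
case/andP: fv => vV vI.
have [Ew|v'w] := eqVneq v' w.
  by rewrite Ew setUCA setD1K.
have v'V' : v' \notin V by move: v'V; rewrite !inE v'w.
have lt : #|v' |: V :\ w| < #|v |: V|.
  by rewrite !cardsU1 v'V vV [#|V|](cardsD1 w) wV.
have [x] := indep_augment v'I vI lt.
rewrite !inE negb_or => /andP[/andP[xv' xw] xv].
case/orP: xv => [/eqP -> |xV]; first by rewrite setUCA.
move: xw; rewrite xV andbT negbK => /eqP ->.
by rewrite setUCA setD1K // => h; move: nf'; rewrite /addable v'V' h.
Qed.

(** [addable_swap] with [w'] in place of [w] makes a superset of the exchanged set independent. *)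
Lemma edge_swap V v w w' v' : addable V v -> w' \in V -> ~~ addable V v' ->
  edge V w' v' -> edge (v |: V :\ w) w' v'.
Proof.
move=> fv w'V nf' e'; have /andP[_ h] := addable_swap fv w'V nf' e'.
have v'v : v' != v by apply: contraNneq nf' => ->.
case/andP: e' => v'V _; apply/andP; split.
  by move: v'V; rewrite !inE (negPf v'v) /=; do 2!case: (_ == _); case: (_ \in _).
apply: indepS h; apply: setUS; apply/subsetP=> x; rewrite !inE.
by case: (x == v); case: (x == w'); case: (x == w); case: (x \in V).
Qed.

Lemma naddable_swap V v w v' : ~~ edge V w v' -> ~~ addable (v |: V :\ w) v'.
Proof.
apply: contra => /andP[v'V h]; apply/andP; split.
  by apply: contra v'V => v'V; rewrite in_setU1 v'V orbT.
by apply: indepS h; rewrite setUS // subsetUr.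
Qed.

(** Drop [v] from a supposed exchange and augment from [V]: regaining [w'] or [w] yields an edge to
    [v'] from [w] or [w'], respectively. *)
Lemma nedge_swap V v w w' v' : addable V v -> w \in V -> w' \in V -> w' != w ->
  ~~ edge V w v' -> ~~ edge V w' v' -> ~~ edge (v |: V :\ w) w' v'.
Proof.
move=> fv wV w'V w'w ne ne'; apply/negP=> /andP[v'V h].
have VI := addable_indep fv; case/andP: fv => vV _.
have v'w : v' != w by apply: contraNneq ne => ->; apply: edge_self.
have v'w' : v' != w' by apply: contraNneq ne' => ->; apply: edge_self.
have vw' : v != w' by apply: contraNneq vV => ->.
have v'nV : v' \notin V.
  by apply: contra v'V => v'V; rewrite !inE v'w' v'w v'V orbT.
have hI : v' |: V :\ w :\ w' \in I.
  by apply: indepS h; rewrite setUS // setSD // subsetUr.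
have w'V' : w' \in V :\ w by rewrite !inE w'w.
have lt : #|v' |: V :\ w :\ w'| < #|V|.
  rewrite cardsU1 (cardsD1 w V) wV (cardsD1 w' (V :\ w)) w'V' ltnS.
  by rewrite leq_add2r leq_b1.
have [x] := indep_augment hI VI lt; rewrite !inE negb_or.
case/andP=> /andP[xv' xV] xinV; rewrite xinV andbT in xV.
rewrite negb_and !negbK in xV; case/orP: xV => /eqP -> {x xv' xinV} xI.
- by case/negP: ne; rewrite /edge !inE (negPf v'nV) andbF /= -(setD1K w'V') setUCA.
- have E : w |: V :\ w :\ w' = V :\ w'.
    by rewrite setDDl [_ :|: [set w']]setUC -setDDl setD1K // !inE wV eq_sym w'w.
  by case/negP: ne'; rewrite /edge !inE (negPf v'nV) andbF /= -E setUCA.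
Qed.

End Exchange.

(** * Matchable sets and augmenting paths *)

Section Transversal.
Context {T : finType} (M : matroid T) (N : T -> {set T}).
Local Notation I := (indep M).
Implicit Types (C K S : {set T}) (m : T -> T).

Definition matching C m :=
  [/\ {in C, forall c, m c \in N c}, {in C &, injective m} & m @: C \in I].

(* The rank of the neighbourhood of [u |: K] is at most [#|K|], so that [u |: C], for
   [u] outside [C], is not matchable. Unlike a failed search for an augmenting path,
   this certificate does not refer to an assignment of [C]. *)
Definition rejected C u := [exists K : {set T}, (K \subset C) &&
  [forall (J | J \in I), (J \subset \bigcup_(c in u |: K) N c) ==> (#|J| <= #|K|)]].

Lemma matching_sub C C' m : C \subset C' -> matching C' m -> matching C m.
Proof.
move=> sC [mN mi mI]; split.
- by move=> c /(subsetP sC); apply: mN.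
- by move=> c d /(subsetP sC) cC /(subsetP sC); apply: mi.
- by apply: indepS mI; apply: imsetS.
Qed.

Lemma rejected_sub C C' u : C \subset C' -> rejected C u -> rejected C' u.
Proof.
move=> sC /existsP[K /andP[KC h]]; apply/existsP; exists K.
by rewrite (subset_trans KC).
Qed.

(** A larger independent [J] would add some [v] to [m @: K]. As [v] cannot be added to [m @: C],
    completing [v |: m @: K] within [v |: m @: C] to the size of [m @: C] omits exactly one [m k].
    This is an edge, so [k] lies in [K], although all of [m @: K] was kept. *)
Lemma closed_rejected C m u K : matching C m -> K \subset C ->
  (forall c v, c \in u |: K -> v \in N c -> ~~ addable M (m @: C) v /\
     forall k, k \in C -> edge M (m @: C) (m k) v -> k \in K) ->
  rejected C u.
Proof.
move=> mm KC h; have [_ mi VI] := mm; set V := m @: C in h VI.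
apply/existsP; exists K; rewrite KC /=; apply/forall_inP=> J JI.
apply/implyP=> sJ; rewrite leqNgt; apply/negP=> lt.
have [_ miK KI] := matching_sub KC mm.
rewrite -(card_in_imset miK) in lt.
have [v /setDP[vJ vK] vI] := indep_augment KI JI lt.
have /bigcupP[c cK vN] := subsetP sJ _ vJ.
have [nf ed] := h _ _ cK vN.
have vV : v \notin V.
  apply/imsetP=> -[k kC Ev]; case/negP: vK; rewrite Ev; apply: imset_f.
  by apply: ed => //; rewrite Ev; apply: edge_self => //; apply: imset_f.
have le : #|v |: m @: K| <= #|V|.
  rewrite leqNgt; apply/negP=> lt'.
  have [x /setDP[]] := indep_augment VI vI lt'.
  rewrite in_setU1 => /orP[/eqP -> _ xI|]; first by case/negP: nf; apply/andP.
  by move=> /(subsetP (imsetS m KC)) ->.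
have [A [AI sA sA' cA]] := indep_extend vI VI le.
have sAV : A \subset v |: V.
  apply: subset_trans sA' _; rewrite -setUA setUS // subUset subxx andbT.
  exact: imsetS.
have [w wV wA] : exists2 w, w \in V & w \notin A.
  apply/subsetPn; apply/negP=> VA.
  have : v |: V \subset A by rewrite subUset VA sub1set (subsetP sA) ?setU11.
  by move/subset_leq_card; rewrite cA cardsU1 vV ltnn.
have /imsetP[k kC Ew] := wV.
have AE : A = v |: V :\ w.
  apply/eqP; rewrite eqEcard; apply/andP; split.
    apply/subsetP=> x xA; have := subsetP sAV _ xA; rewrite !inE.
    by case: (x == v) => //= ->; rewrite andbT; apply: contraNneq wA => <-.
  by rewrite cA cardsU1 !inE (negPf vV) andbF (cardsD1 w V) wV.
have kK : k \in K.
  by apply: ed => //; rewrite -Ew /edge -AE AI !inE (negPf vV) andbF.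
case/negP: wA; apply: (subsetP sA); rewrite in_setU1 Ew; apply/orP; right.
exact: imset_f.
Qed.

(* The certificates of the rejected elements of [S] are pooled into one set [K];
   [m @: K] is then a maximal independent subset of the union of the
   neighbourhoods of [K] and of these elements. *)
Lemma rejected_card C S m m' : matching C m -> matching S m' ->
  {in S :\: C, forall x, rejected C x} -> #|S| <= #|C|.
Proof.
move=> mm mm' rej.
pose cert x (K : {set T}) := (K \subset C) &&
  [forall (J | J \in I), (J \subset \bigcup_(c in x |: K) N c) ==> (#|J| <= #|K|)].
pose Kx x := odflt set0 [pick K | cert x K].
have KxP x : x \in S :\: C -> cert x (Kx x).
  move=> /rej/existsP[K hK]; rewrite /Kx; case: pickP => [//|/(_ K)].
  by rewrite /cert hK.
pose K := \bigcup_(x in S :\: C) Kx x.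
have KC : K \subset C by apply/bigcupsP=> x /KxP/andP[].
have [_ miK KI] := matching_sub KC mm.
pose S' := (S :\: C) :|: (S :&: K).
have S'S : S' \subset S by rewrite subUset subsetDl subsetIl.
have [mN' mi' JI] := matching_sub S'S mm'.
have leK : #|S'| <= #|K|.
  rewrite -(card_in_imset miK) -(card_in_imset mi') leqNgt; apply/negP=> lt.
  have [v /setDP[/imsetP[y yS' Ev] vK] vI] := indep_augment KI JI lt.
  have [x xS yx] : exists2 x, x \in S :\: C & y \in x |: Kx x.
    move: yS'; rewrite in_setU => /orP[yS|].
      by exists y => //; rewrite setU11.
    rewrite inE => /andP[_ /bigcupP[x xS yx]].
    by exists x => //; rewrite setU1r.
  (* The violation is localised at the certificate of [x] alone: [v |: m @: Kx x] is one point too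
     large for it. *)
  have /andP[KxC /forall_inP/(_ (v |: m @: Kx x))] := KxP _ xS.
  have KxK : Kx x \subset K by apply: bigcup_sup.
  have KxI : m @: Kx x \subset m @: K by apply: imsetS.
  have [mNx mix _] := matching_sub KxC mm.
  have vKx : v \notin m @: Kx x by apply: contra vK => /(subsetP KxI).
  rewrite (indepS _ vI) ?setUS // => /(_ isT)/implyP.
  rewrite cardsU1 vKx card_in_imset // ltnn => h; case: notF; apply: h.
  rewrite subUset sub1set; apply/andP; split.
    by apply/bigcupP; exists y => //; rewrite Ev; apply: mN'.
  apply/subsetP=> _ /imsetP[c cK ->]; apply/bigcupP; exists c; last exact: mNx.
  exact: setU1r.
(* [S] splits into [S'], bounded by [K], and [S :&: C :\: K], bounded by [C :\: K]. *)
rewrite -(cardsID C S) -(cardsID K (S :&: C)) -(cardsID K C).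
have -> : C :&: K = K by apply/setIidPr.
have -> : S :&: C :&: K = S :&: K by rewrite -setIA; congr (_ :&: _); apply/setIidPr.
have -> : #|S :&: K| + #|S :&: C :\: K| + #|S :\: C| = #|S'| + #|S :&: C :\: K|.
  rewrite addnAC; congr (_ + _); rewrite cardsU addnC.
  suff -> : (S :\: C) :&: (S :&: K) = set0 by rewrite cards0 subn0.
  apply/setP=> x; rewrite !inE; have := subsetP KC x.
  by case: (x \in K); case: (x \in C); rewrite ?andbF //= => /(_ isT).
by rewrite leq_add // subset_leq_card // setSD // subsetIr.
Qed.

(* A path from [u] to [c] along which [c] could be given the new point [v]: [par k]
   precedes [k] and would take over the point of [k] in the form of [pv k]. The last
   field excludes shortcuts; it makes the other fields survive a reassignment. *)
Record augpath C m u K (lev : T -> nat) (par pv : T -> T) c v : Prop := AugPath {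
  ap_matching : matching C m;
  ap_root : u \notin C;
  ap_sub : K \subset C;
  ap_cur : c \in u |: K;
  ap_next : v \in N c;
  ap_free : addable M (m @: C) v;
  ap_par : {in K, forall k, par k \in u |: K};
  ap_lev : {in K, forall k, lev (par k) < lev k};
  ap_pv : {in K, forall k, pv k \in N (par k)};
  ap_edge : {in K, forall k, edge M (m @: C) (m k) (pv k)};
  ap_nfree : {in K, forall k, ~~ addable M (m @: C) (pv k)};
  ap_nedge : {in K &, forall k k', lev (par k') < lev (par k) ->
    ~~ edge M (m @: C) (m k) (pv k')} }.

Definition reassign m c v : T -> T := fun x => if x == c then v else m x.

Lemma reassign_imset C m c v : {in C &, injective m} -> c \in C ->
  reassign m c v @: C = v |: (m @: C) :\ m c.
Proof.
move=> mi cC; apply/setP=> y; rewrite !inE; apply/imsetP/idP.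
  case=> x xC ->; rewrite /reassign; have [_|xc] := eqVneq x c; first by rewrite eqxx.
  by rewrite (inj_in_eq mi) // xc imset_f // orbT.
case/orP=> [/eqP ->|/andP[ym /imsetP[x xC Ey]]].
  by exists c => //; rewrite /reassign eqxx.
by exists x => //; rewrite /reassign; case: (eqVneq x c) Ey ym => // -> ->; rewrite eqxx.
Qed.

(** The end [c] trades its point for [v], and [par c] becomes the new end, to receive [pv c].
    Restricting to levels up to that of [par c] discards [c] itself. *)
Lemma augpath_step C m u K lev par pv c v : c != u ->
  augpath C m u K lev par pv c v ->
  augpath C (reassign m c v) u [set k in K | lev k <= lev (par c)] lev par pv
    (par c) (pv c).
Proof.
move=> cu [mm uC KC cK vN fv hpar hlev hpv hed hnf hne].
have cK' : c \in K by move: cK; rewrite in_setU1 (negPf cu).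
have cC := subsetP KC _ cK'.
have [mN mi VI] := mm; set V := m @: C in VI fv hed hnf hne *.
have VE : reassign m c v @: C = v |: V :\ m c by apply: reassign_imset.
have wV : m c \in V by apply: imset_f.
set K' := [set k in K | _].
have K'K : {subset K' <= K} by move=> k; rewrite inE => /andP[].
have K'c k : k \in K' -> k != c.
  rewrite inE => /andP[_]; apply: contraTneq => ->; by rewrite -ltnNge hlev.
have K'm k : k \in K' -> reassign m c v k = m k.
  by move=> /K'c; rewrite /reassign => /negPf ->.
have K'w k : k \in K' -> m k != m c.
  move=> kK; rewrite (inj_in_eq mi) ?K'c // (subsetP KC) //; exact: K'K.
have K'V k : k \in K' -> m k \in V by move=> /K'K/(subsetP KC) kC; apply: imset_f.
(* An edge from [m c] to [pv k] would be a shortcut. Its absence preserves [ap_nfree] and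
   [ap_nedge]. *)
have K'e k : k \in K' -> ~~ edge M V (m c) (pv k).
  move=> kK; apply: hne => //; first exact: K'K.
  move: kK; rewrite inE => /andP[kK]; apply: leq_trans; exact: hlev.
split=> //.
- split=> [d dC|d e dC eC|].
  + by rewrite /reassign; have [->//|_] := eqVneq; apply: mN.
  + have vnm x : x \in C -> m x <> v.
      by move=> xC Ev; case/andP: fv; rewrite -Ev imset_f.
    rewrite /reassign; have [->|_] := eqVneq d; have [->|_] := eqVneq e => //.
    * by move/esym/(vnm _ eC).
    * by move/(vnm _ dC).
    * exact: mi.
  + rewrite VE; case/andP: fv => _; apply: indepS.
    by rewrite setUS // subD1set.
- by apply/subsetP=> k /K'K/(subsetP KC).
- have := hpar _ cK'; rewrite !in_setU1 inE => /orP[->//|->].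
  by rewrite leqnn orbT.
- exact: hpv.
- by rewrite VE; apply: addable_swap => //; [apply: hnf | apply: hed].
- move=> k kK'; have := hpar _ (K'K _ kK'); rewrite !in_setU1 inE.
  case/orP=> [->//|->]; move: kK'; rewrite inE => /andP[kK kl].
  by rewrite (leq_trans (ltnW (hlev _ kK)) kl) orbT.
- by move=> k /K'K; apply: hlev.
- by move=> k /K'K; apply: hpv.
- move=> k kK; rewrite VE K'm //; have kK2 := K'K _ kK.
  by apply: edge_swap; [ | exact: K'V | exact: hnf | exact: hed].
- move=> k kK; rewrite VE; apply: naddable_swap; exact: K'e.
- move=> k k' kK kK' lt; rewrite VE K'm //; apply: nedge_swap => //.
  + exact: K'V.
  + exact: K'w.
  + exact: K'e.
  + by apply: hne => //; apply: K'K.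
Qed.

Lemma augpath_end C m u K lev par pv v : augpath C m u K lev par pv u v ->
  reassign m u v @: (u |: C) = v |: m @: C /\ matching (u |: C) (reassign m u v).
Proof.
case=> [[mN mi VI] uC _ _ vN /andP[vV vI] _ _ _ _ _ _].
have mE x : x \in C -> reassign m u v x = m x.
  by rewrite /reassign => xC; case: eqVneq xC => // ->; rewrite (negPf uC).
have mu : reassign m u v u = v by rewrite /reassign eqxx.
have E : reassign m u v @: (u |: C) = v |: m @: C.
  rewrite imsetU1 mu; congr (_ |: _); apply: eq_in_imset => x; exact: mE.
split=> //; split; last by rewrite E.
  by move=> c; rewrite in_setU1 => /orP[/eqP ->|cC]; rewrite ?mu ?mE //; apply: mN.
have vnm x : x \in C -> m x <> v by move=> xC Ev; rewrite -Ev imset_f in vV.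
move=> d e; rewrite !in_setU1 => /orP[/eqP ->|dC] /orP[/eqP ->|eC] //.
- by rewrite mu mE // => /esym/(vnm _ eC).
- by rewrite mu mE // => /(vnm _ dC).
- by rewrite !mE //; apply: mi.
Qed.

End Transversal.

(** * The greedy bound *)

Local Open Scope ring_scope.

Section Greedy.
Context {R : realType} {X : finMetricType R} (w : X -> R).
Hypothesis w_ge0 : forall x, 0 <= w x.
Variables (M : matroid X) (r : R).
Hypothesis r_ge0 : 0 <= r.
Implicit Types (us : seq X) (A B F D : {set X}).

Local Notation N := (fun c : X => cball c (r + r)).

Lemma weight_ge0 A : 0 <= weight w A.
Proof. exact: sumr_ge0. Qed.

Lemma weightID A B : weight w A = weight w (A :&: B) + weight w (A :\: B).
Proof. exact: big_setID. Qed.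

Lemma weight_sub A B : A \subset B -> weight w A <= weight w B.
Proof.
by move=> /setIidPr AB; rewrite (weightID B A) AB lerDl weight_ge0.
Qed.

Lemma weightU A B : weight w (A :|: B) <= weight w A + weight w B.
Proof.
rewrite (weightID _ A) setUK lerD2l; apply: weight_sub.
by rewrite setDUl setDv set0U subsetDl.
Qed.

Lemma weight_bigcup D (G : X -> {set X}) :
  weight w (\bigcup_(x in D) G x) <= \sum_(x in D) weight w (G x).
Proof.
elim/big_ind2: _ => [|A a B b Aa Bb|//]; first by rewrite /weight big_set0.
by apply: le_trans (weightU _ _) _; apply: lerD.
Qed.

Definition cov us : {set X} := \bigcup_(u <- us) cball u (r + r + r).

Definition gain us u := weight w (cball u r :\: cov us).

(* The most recently accepted point comes first. *)
Fixpoint greedy us : Prop :=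
  if us is u :: us' then
    [/\ u \notin us',
        forall x, rejected M N [set y in us'] x \/ gain us' x <= gain us' u
      & greedy us']
  else True.

Fixpoint hits F us : {set X} :=
  if us is u :: us' then
    if [disjoint cball u r :\: cov us' & cballU F r] then hits F us'
    else u |: hits F us'
  else set0.

Fixpoint missed F us : R :=
  if us is u :: us' then
    (if [disjoint cball u r :\: cov us' & cballU F r] then gain us' u else 0)
    + missed F us'
  else 0.

Lemma cov_cons u us : cov (u :: us) = cball u (r + r + r) :|: cov us.
Proof. by rewrite /cov big_cons. Qed.

Lemma cball_cov u us : u \in us -> cball u (r + r + r) \subset cov us.
Proof. by move=> uus; rewrite /cov (big_rem u uus) subsetUl. Qed.

(** Points accepted earlier thus satisfy the comparison in [greedy] trivially. *)
Lemma gain_mem u us : u \in us -> gain us u = 0.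
Proof.
move=> uus; rewrite /gain /weight big1 // => x; rewrite inE => /andP[xc].
rewrite inE => xu; case/negP: xc; apply: (subsetP (cball_cov uus)).
by rewrite inE (le_trans xu) // -addrA lerDl addr_ge0.
Qed.

(** The triangle inequality through a common point; this fixes the radii [2r] for assignment and
    [3r] for covering. *)
Lemma cball_inter u f : ~~ [disjoint cball u r & cball f r] ->
  (f \in N u) && (cball f r \subset cball u (r + r + r)).
Proof.
case/pred0Pn=> x /andP[]; rewrite !inE => ux fx.
have uf : mdist u f <= r + r.
  by apply: le_trans (metric_triangle _ x _) _; rewrite lerD // metric_sym.
rewrite uf; apply/subsetP=> y; rewrite !inE => fy.
by apply: le_trans (metric_triangle _ f _) _; rewrite lerD.
Qed.

Lemma hits_sub F us : hits F us \subset [set x in us].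
Proof.
elim: us => [|u us IH] /=; first exact: sub0set.
have s : [set x in us] \subset [set x in u :: us].
  by apply/subsetP=> x; rewrite !inE orbC => ->.
case: ifP => _; first exact: subset_trans s.
by rewrite subUset sub1set !inE eqxx (subset_trans IH).
Qed.

(** The gains summed are weights of disjoint sets outside the balls of [F], each uncovered until its
    point was accepted. *)
Lemma missed_le F us : missed F us <= weight w (cov us :\: cballU F r).
Proof.
elim: us => [|u us IH] /=; first exact: weight_ge0.
rewrite cov_cons; case: ifP => [dis|_]; last first.
  by rewrite add0r (le_trans IH) // weight_sub // setSD // subsetUr.
rewrite (weightID _ (cball u r :\: cov us)) lerD //.
  apply: weight_sub; rewrite subsetI subxx andbT subsetD dis andbT.
  apply/subsetP=> x; rewrite !inE => /andP[_ h].
  by rewrite (le_trans h) // -addrA lerDl addr_ge0.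
apply: le_trans IH _; apply: weight_sub.
apply/subsetP=> x; rewrite !inE => /andP[-> ->].
by rewrite orbT.
Qed.

(** A hit [u] gets a point of [F] whose ball contains a still uncovered point of the ball of [u].
    Earlier witnesses have covered balls, so the new one differs from them. *)
Lemma hits_witness F us : greedy us -> exists phi : X -> X,
  [/\ {in hits F us, forall u, phi u \in F},
      {in hits F us, forall u, phi u \in N u},
      {in hits F us, forall u, cball (phi u) r \subset cov us} &
      {in hits F us &, injective phi}].
Proof.
elim: us => [|u us IH] /=.
  by exists id; split=> u; rewrite inE.
case=> uus _ /IH[phi [pF pN pc pi]].
have pc' v : v \in hits F us -> cball (phi v) r \subset cov (u :: us).
  by move=> /pc h; rewrite cov_cons (subset_trans h) // subsetUr.
case: ifPn => [_|]; first by exists phi; split.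
case/pred0Pn=> x /andP[] /=; rewrite inE => /andP[xcov xu] /bigcupP[f fF xf].
have /cball_inter/andP[fN fc] : ~~ [disjoint cball u r & cball f r].
  by apply/pred0Pn; exists x; apply/andP.
exists (reassign phi u f).
have uh : u \notin hits F us.
  by apply: contra uus => /(subsetP (hits_sub F us)); rewrite inE.
have pE v : v \in hits F us -> reassign phi u f v = phi v.
  by rewrite /reassign => vh; case: eqVneq vh => // ->; rewrite (negPf uh).
have pu : reassign phi u f u = f by rewrite /reassign eqxx.
have pf v : v \in hits F us -> phi v <> f.
  by move=> /pc h E; case/negP: xcov; apply: (subsetP h); rewrite E.
split=> [v|v|v|v v']; rewrite ?in_setU1.
- by case/orP=> [/eqP ->|h]; rewrite ?pu ?pE //; apply: pF.
- by case/orP=> [/eqP ->|h]; rewrite ?pu ?pE //; apply: pN.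
- case/orP=> [/eqP ->|h]; rewrite ?pu ?pE //; last exact: pc'.
  by rewrite cov_cons (subset_trans fc) // subsetUl.
- case/orP=> [/eqP ->|h] /orP[/eqP ->|h'] //; rewrite ?pu ?pE //.
  + by move/esym/pf.
  + by move/pf.
  + exact: pi.
Qed.

Section Counting.
Variables (F E : {set X}) (phi : X -> X).
Hypothesis FI : F \in indep M.

(** [E] stands for the final covered set; it and [phi] stay fixed while the induction passes to
    shorter [us]. *)
Definition witness us := [/\ {in hits F us, forall u, phi u \in F},
  {in hits F us, forall u, phi u \in N u},
  {in hits F us, forall u, cball (phi u) r \subset E} &
  {in hits F us &, injective phi}].

Local Notation Funcov := [set f in F | ~~ (cball f r \subset E)].

Lemma uncov_notin us f : cov us \subset E -> f \in Funcov -> f \notin us.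
Proof.
move=> covE; rewrite inE => /andP[_]; apply: contra => fus.
apply: subset_trans covE; apply: subset_trans (cball_cov fus).
apply/subsetP=> x; rewrite !inE => /le_trans -> //.
by rewrite -addrA lerDl addr_ge0.
Qed.

Lemma greedy_uniq us : greedy us -> uniq us.
Proof. by elim: us => //= u us IH [-> _ /IH]. Qed.

(** [D] and the hits together are matchable: hits go to their [phi], points of [D] to themselves.
    The images differ because the balls around the former lie in [E] and those around the latter do
    not. Now [rejected_card] applies. *)
Lemma rejected_hits us m D : greedy us -> matching M N [set x in us] m ->
  cov us \subset E -> witness us -> D \subset Funcov ->
  {in D, forall f, rejected M N [set x in us] f} ->
  (#|D| + #|hits F us| <= size us)%N.
Proof.
move=> gr mm covE [pF pN pE pi] DF rej.
have usE : #|[set x in us]| = size us.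
  by rewrite cardsE; apply/card_uniqP/greedy_uniq.
have hus v : v \in hits F us -> v \in us.
  by move=> /(subsetP (hits_sub F us)); rewrite inE.
have Dus f : f \in D -> f \notin us.
  by move/(subsetP DF); apply: uncov_notin.
have Dhn f : f \in D -> f \in hits F us = false.
  by move=> fD; apply: contraNF (Dus _ fD) => /hus.
have Dh : [disjoint D & hits F us].
  by apply/pred0P=> f /=; apply/negP=> /andP[/Dhn ->].
pose S := D :|: hits F us.
have cS : #|S| = (#|D| + #|hits F us|)%N.
  by apply/eqP; have [_ ->] := leq_card_setU D (hits F us).
pose m' x := if x \in hits F us then phi x else x.
have mS : matching M N S m'.
  have nm f h : f \in D -> h \in hits F us -> f <> phi h.
    move=> /(subsetP DF); rewrite inE => /andP[_ nf] /pE hE Ef.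
    by rewrite Ef hE in nf.
  split.
  - move=> c; rewrite in_setU /m' => /orP[cD|ch].
      by rewrite Dhn // inE mdistxx addr_ge0.
    by rewrite ch; apply: pN.
  - move=> c d; rewrite !in_setU /m' => /orP[cD|ch] /orP[dD|dh].
    + by rewrite !Dhn.
    + by rewrite dh Dhn // => /nm; case.
    + by rewrite ch Dhn // => /esym/nm; case.
    + by rewrite ch dh; apply: pi.
  - apply: indepS FI; apply/subsetP=> _ /imsetP[c cS' ->].
    move: cS'; rewrite in_setU /m' => /orP[cD|ch].
      by rewrite Dhn //; move: (subsetP DF _ cD); rewrite inE => /andP[].
    by rewrite ch; apply: pF.
rewrite -cS -usE; apply: rejected_card mm mS _ => x.
rewrite !inE => /andP[xus /orP[xD|xh]]; first exact: rej.
by rewrite (hus _ xh) in xus.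
Qed.

(* Induction on [us]: when the last chosen point [u] is not a hit and [D] is as
   large as the counting bound permits, some [f] in [D] was not yet rejected when
   [u] was chosen, and is charged to [u]. *)
Lemma missed_ge us m D : greedy us ->
  matching M N [set x in us] m -> cov us \subset E -> witness us ->
  D \subset Funcov -> (#|D| + #|hits F us| <= size us)%N ->
  \sum_(f in D) weight w (cball f r :\: E) <= missed F us.
Proof.
elim: us D => [|u us IH] D gr mm covE wit DF.
  rewrite [#|hits _ _|]cards0 addn0 leqn0 cards_eq0 => /eqP ->.
  by rewrite big_set0.
have s : [set x in us] \subset [set x in u :: us].
  by apply/subsetP=> x; rewrite !inE orbC => ->.
have mm' := matching_sub s mm.
have covE' : cov us \subset E.
  by apply: subset_trans covE; rewrite cov_cons subsetUr.
have wit' : witness us.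
  have sh : {subset hits F us <= hits F (u :: us)}.
    by move=> v vh /=; case: ifP => // _; rewrite setU1r.
  case: wit => pF pN pE pi; split=> [v /sh/pF|v /sh/pN|v /sh/pE|v v' /sh hv /sh] //.
  exact: pi.
have [uus gu gr'] := gr.
have {}IH D' := IH D' gr' mm' covE' wit'.
rewrite /=; case: ifPn => [dis|ndis]; last first.
  (* A hit adds one to both sides of the counting bound, so the induction hypothesis applies to the
     same [D]. *)
  have uh : u \notin hits F us.
    by apply: contra uus => /(subsetP (hits_sub F us)); rewrite inE.
  by rewrite cardsU1 uh addnCA ltnS add0r => /IH; apply.
move=> le.
have [le'|lt] := leqP (#|D| + #|hits F us|)%N (size us).
  by apply: le_trans (IH _ DF le') _; rewrite lerDr weight_ge0.
have [f fD nrej] : exists2 f, f \in D & ~~ rejected M N [set x in us] f.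
  apply/exists_inP; apply: contraLR lt; rewrite negb_exists_in -leqNgt.
  move=> /forall_inP rej; apply: rejected_hits gr' mm' covE' wit' DF _.
  by move=> f /rej; rewrite negbK.
have fg : weight w (cball f r :\: E) <= gain us u.
  case: (gu f) => [rej|]; first by rewrite rej in nrej.
  by apply: le_trans; apply: weight_sub; apply: setDS.
rewrite (big_setD1 f) //= lerD // IH //.
  exact: subset_trans (subD1set _ _) DF.
by move: le; rewrite (cardsD1 f D) fD.
Qed.

End Counting.

Lemma greedy_cover F us m : F \in indep M -> greedy us ->
  matching M N [set x in us] m ->
  (forall x, x \in us \/ rejected M N [set y in us] x) ->
  weight w (cballU F r) <= weight w (cov us).
Proof.
move=> FI gr mm compl.
have [phi wit] := hits_witness F gr.
pose D := [set f in F | ~~ (cball f r \subset cov us)].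
have DE : weight w (cballU F r :\: cov us) <=
    \sum_(f in D) weight w (cball f r :\: cov us).
  apply: le_trans (weight_bigcup _ _); apply: weight_sub.
  apply/subsetP=> x; rewrite inE => /andP[xc /bigcupP[f fF xf]].
  apply/bigcupP; exists f; last by rewrite inE xc.
  by rewrite inE fF; apply/subsetPn; exists x.
rewrite (weightID _ (cov us)) (weightID (cov us) (cballU F r)) setIC lerD2l.
apply: le_trans DE _; apply: le_trans (missed_le F us).
apply: (missed_ge FI gr mm (subxx _) wit (subxx _)).
apply: (rejected_hits FI gr mm (subxx _) wit (subxx _)) => f.
by move/(uncov_notin (subxx _)); case: (compl f) => // ->.
Qed.

(** A covered point is within [3r] of its center, which is within [2r] of the point assigned to
    it. *)
Lemma cov_sub us m : matching M N [set x in us] m ->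
  cov us \subset cballU (m @: [set x in us]) (5%:R * r).
Proof.
case=> mN _ _; rewrite /cov big_tnth; apply/bigcupsP=> i _.
set u := tnth _ _; have uus : u \in [set x in us] by rewrite inE mem_tnth.
apply/subsetP=> x xu; apply/bigcupP; exists (m u); first exact: imset_f.
have := mN _ uus; move: xu; rewrite !inE => ux um.
apply: le_trans (metric_triangle _ u _) _; rewrite metric_sym.
by rewrite mulr_natl !mulrS mulr0n addr0 addrA lerD // addrA.
Qed.

End Greedy.

Local Close Scope ring_scope.

(** * Running programs *)

(* Every loop below makes at most [n] iterations. *)
Fixpoint cost (c : cmd) : {poly nat} :=
  match c with
  | CSkip | CSetN _ _ _ | CSetR _ _ _ => 1
  | CSeq c1 c2 => cost c1 + cost c2
  | CIf _ c1 c2 => cost c1 + cost c2 + 1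
  | CWhile _ c1 => 'X * (cost c1 + 1) + 1
  end%R.

Local Notation "c1 ;; c2" := (CSeq c1 c2) (at level 100, right associativity).
Local Coercion NConst : nat >-> nexp.
Definition var (a : nat) : nexp := NGet a 0.
Definition setvar (a : nat) (e : nexp) : cmd := CSetN a 0 e.
Definition for_points (i : nat) (c : cmd) : cmd :=
  CSeq (setvar i 0) (CWhile (BLeN (NAdd (var i) 1) NPoints)
    (CSeq c (setvar i (NAdd (var i) 1)))).

Lemma cost_if b c1 c2 n :
  (cost (CIf b c1 c2)).[n]%R = ((cost c1).[n]%R + (cost c2).[n]%R).+1.
Proof. by rewrite -addn1 /= !hornerD hornerC. Qed.

Lemma cost_while b c n :
  (cost (CWhile b c)).[n]%R = n * ((cost c).[n]%R).+1 + 1.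
Proof. by rewrite -addn1 /= hornerD hornerM hornerX hornerD !hornerC. Qed.

Section Run.
Context {R : realType} (A : rmc_instance R) (r : R).
Local Notation X := (points A).
Local Notation n := #|X|.
Local Notation state := (state (R := R)).
Implicit Types (s : state) (Q : state -> Prop).

(** Total correctness and the time bound in one judgement, so that the rules below compose as for
    weakest preconditions. *)
Definition run c s Q := exists t s',
  [/\ exec A r c s t s', t <= (cost c).[n]%R & Q s'].

Definition setn s a i v : state := State (update (nmem s) a i v) (rmem s).
Definition setr s a i v : state := State (nmem s) (update (rmem s) a i v).

Lemma run_skip s Q : Q s -> run CSkip s Q.
Proof. by exists 1, s; split=> //=; [constructor | rewrite hornerC]. Qed.

Lemma run_setN a i e s Q :
  Q (setn s a (neval A s i) (neval A s e)) -> run (CSetN a i e) s Q.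
Proof. by move=> q; do 2!eexists; split; [constructor | rewrite hornerC | ]. Qed.

Lemma run_setR a i e s Q :
  Q (setr s a (neval A s i) (reval A r s e)) -> run (CSetR a i e) s Q.
Proof. by move=> q; do 2!eexists; split; [constructor | rewrite hornerC | ]. Qed.

Lemma run_seq c1 c2 s Q : run c1 s (fun s1 => run c2 s1 Q) -> run (CSeq c1 c2) s Q.
Proof.
case=> t1 [s1 [e1 l1 [t2 [s2 [e2 l2 q]]]]]; exists (t1 + t2), s2; split=> //.
  exact: ExSeq e1 e2.
by rewrite hornerD leq_add.
Qed.

Lemma run_if b c1 c2 s Q :
  (beval A r s b -> run c1 s Q) -> (~~ beval A r s b -> run c2 s Q) ->
  run (CIf b c1 c2) s Q.
Proof.
move=> h1 h2; case: (boolP (beval A r s b)) => [bb|nb].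
  have [t [s' [e l q]]] := h1 bb; exists t.+1, s'; split=> //.
    by constructor; rewrite bb.
  by rewrite cost_if ltnS (leq_trans l) // leq_addr.
have [t [s' [e l q]]] := h2 nb; exists t.+1, s'; split=> //.
  by constructor; rewrite (negPf nb).
by rewrite cost_if ltnS (leq_trans l) // leq_addl.
Qed.

Lemma run_mono c s Q Q' : (forall s', Q s' -> Q' s') -> run c s Q -> run c s Q'.
Proof. by move=> h [t [s' [e l q]]]; exists t, s'; split=> //; apply: h. Qed.

Lemma run_while (I : nat -> state -> Prop) b c s Q :
  I n s ->
  (forall k s, I k s -> beval A r s b -> 0 < k /\ run c s (I k.-1)) ->
  (forall k s, I k s -> ~~ beval A r s b -> Q s) ->
  run (CWhile b c) s Q.
Proof.
move=> i0 hs hq.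
suff h k s0 : I k s0 -> exists t s', [/\ exec A r (CWhile b c) s0 t s',
    t <= k * ((cost c).[n]%R).+1 + 1 & Q s'].
  have [t [s' [e l q]]] := h _ _ i0; exists t, s'; split=> //.
  by rewrite cost_while.
elim: k s0 => [|k IH] s0 ik.
  case: (boolP (beval A r s0 b)) => [/(hs _ _ ik)[]//|nb].
  by exists 1, s0; split; [exact: ExWhileF | | exact: hq ik nb].
case: (boolP (beval A r s0 b)) => [bb|nb]; last first.
  by exists 1, s0; split; [exact: ExWhileF | rewrite addn1 | exact: hq ik nb].
have [_ [t1 [s1 [e1 l1 /IH[t2 [s2 [e2 l2 q]]]]]]] := hs _ _ ik bb.
exists (t1 + t2).+1, s2; split=> //; first exact: ExWhileT e1 e2.
by rewrite mulSn !addSn -addnA ltnS leq_add.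
Qed.

Lemma run_for (I : nat -> state -> Prop) i c s Q :
  I 0 (setn s i 0 0) ->
  (forall k s, k < n -> nmem s i 0 = k -> I k s ->
     run c s (fun s' => nmem s' i 0 = k /\ I k.+1 (setn s' i 0 k.+1))) ->
  (forall s, I n s -> Q s) ->
  run (for_points i c) s Q.
Proof.
have updE (s0 : state) v : nmem (setn s0 i 0 v) i 0 = v.
  by rewrite /= /update !eqxx.
move=> i0 hs hq; apply: run_seq; apply: run_setN => /=.
(* The index of [run_while] counts down while the counter [i] counts up. *)
pose J k s := [/\ k <= n, nmem s i 0 = n - k & I (n - k) s].
apply: (run_while (I := J)).
- by split; rewrite ?subnn ?updE.
- move=> k s0 [kn ik Ik] /=; rewrite ik => lt.
  have k0 : 0 < k by rewrite lt0n; apply: contraTneq lt => ->; rewrite subn0 addn1 ltnn.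
  split=> //; apply: run_seq.
  have lt' : n - k < n by rewrite -[n - k < n]/((n - k).+1 <= n) -addn1.
  apply: run_mono (hs _ _ lt' ik Ik) => s1 [ik1 Ik1].
  apply: run_setN; rewrite /= ik1 addn1.
  have E : n - k.-1 = (n - k).+1 by rewrite -[in RHS](prednK k0) subnSK // prednK.
  by split; rewrite ?E ?updE // (leq_trans (leq_pred _) kn).
- move=> k s0 [kn ik Ik] /=; rewrite ik addn1 -leqNgt => le; apply: hq.
  by rewrite (_ : n = n - k) //; apply/eqP; rewrite eqn_leq le leq_subr.
Qed.

(** * Numbering of the points and characteristic arrays *)

Definition rk (x : X) : nat := enum_rank x.

Lemma rk_lt x : rk x < n. Proof. exact: ltn_ord. Qed.

Lemma rk_inj : injective rk.
Proof. by move=> x y /val_inj/enum_rank_inj. Qed.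

Lemma rk_eq x y : (rk x == rk y) = (x == y).
Proof. exact: inj_eq rk_inj x y. Qed.

Lemma rkP k : k < n -> exists x, k = rk x.
Proof.
by move=> kn; exists (enum_val (Ordinal kn)); rewrite /rk enum_valK.
Qed.

Lemma run_for_points (I : nat -> state -> Prop) i c s Q :
  I 0 (setn s i 0 0) ->
  (forall x s, nmem s i 0 = rk x -> I (rk x) s ->
     run c s (fun s' => nmem s' i 0 = rk x /\ I (rk x).+1 (setn s' i 0 (rk x).+1))) ->
  (forall s, I n s -> Q s) ->
  run (for_points i c) s Q.
Proof.
move=> i0 hs; apply: run_for => // k s0 /rkP[x ->]; exact: hs.
Qed.

Lemma onth_rk x : onth (enum X) (rk x) = Some x.
Proof.
by rewrite (onthE _) (nth_map x) ?nth_enum_rank // -cardE rk_lt.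
Qed.

Lemma dist_inputE x y : dist_input A (rk x) (rk y) = mdist x y.
Proof. by rewrite /dist_input !onth_rk. Qed.

Lemma weight_inputE x : weight_input A (rk x) = wt x.
Proof. by rewrite /weight_input onth_rk. Qed.

Definition arr (f : nat -> nat) (S : {set X}) := forall x, f (rk x) = (x \in S).

Lemma arr_decode f S : arr f S -> decode_set A f = S.
Proof. by move=> h; apply/setP=> x; rewrite inE [f _]h eqb0 negbK. Qed.

Lemma arr_set1 f S x : arr f S ->
  arr (fun j => if j == rk x then 1 else f j) (x |: S).
Proof. by move=> h y; rewrite rk_eq !inE h; case: (y == x). Qed.

Lemma arr_set0 f S x : arr f S ->
  arr (fun j => if j == rk x then 0 else f j) (S :\ x).
Proof. by move=> h y; rewrite rk_eq !inE h; case: (y == x). Qed.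

End Run.

(** * The program *)

(* Memory. Natural number arrays: 0 the assigned points (the output); 1 the point
   assigned to a center; 2 the centers; 3 the points already considered; 4 the
   covered points; 5 the points reached by the search; 6 its queue; 7 and 8 the
   predecessor of a reached point and the point through which it was reached.
   Variables: 10 to 16 loop counters; 20 whether [select] succeeded, 21 the selected
   point; 22 the length of the queue; 23 whether the search succeeded, 24 the center
   and 25 the point where the path ends; 26 and 27 temporary. Reals: 0 the uncovered
   weight of the current candidate, 1 that of the best one. *)

(** The oracle only reads arrays, so the candidate is entered in array 0, tested and withdrawn. *)
Definition try_add : cmd :=
  CIf (BLeN (NGet 0 (var 14)) 0)
    (CSetN 0 (var 14) 1;;
     CIf (BIndep 0)
       (setvar 23 1;; setvar 24 (var 27);; setvar 25 (var 14)) CSkip;;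
     CSetN 0 (var 14) 0)
    CSkip.

(** The candidate is cleared before the removed point is restored; the order matters when both are
    the same point. *)
Definition scan_edge : cmd :=
  CIf (BAnd (BLeN 1 (NGet 2 (var 15))) (BLeN (NGet 5 (var 15)) 0))
    (setvar 26 (NGet 1 (var 15));;
     CSetN 0 (var 26) 0;;
     CIf (BLeN (NGet 0 (var 14)) 0)
       (CSetN 0 (var 14) 1;;
        CIf (BIndep 0)
          (CSetN 5 (var 15) 1;; CSetN 7 (var 15) (var 27);;
           CSetN 8 (var 15) (var 14);; CSetN 6 (var 22) (var 15);;
           setvar 22 (NAdd (var 22) 1))
          CSkip;;
        CSetN 0 (var 14) 0)
       CSkip;;
     CSetN 0 (var 26) 1)
    CSkip.

Definition scan_point : cmd :=
  CIf (BAnd (BLeN (var 23) 0)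
            (BLeR (RDist (var 27) (var 14)) (RAdd RRadius RRadius)))
    (try_add;; CIf (BLeN (var 23) 0) (for_points 15 scan_edge) CSkip)
    CSkip.

(** The queue holds at most [n] points, so a counted loop over its positions suffices; positions
    past its end are skipped. *)
Definition search : cmd :=
  for_points 11 (CSetN 5 (var 11) 0);;
  CSetN 5 (var 21) 1;; CSetN 6 0 (var 21);; setvar 22 1;; setvar 23 0;;
  for_points 13
    (CIf (BAnd (BLeN (NAdd (var 13) 1) (var 22)) (BLeN (var 23) 0))
       (setvar 27 (NGet 6 (var 13));; for_points 14 scan_point) CSkip).

(** * Correctness of the search *)

Section Search.
Context {R : realType} (A : rmc_instance R) (r : R).
Local Notation X := (points A).
Local Notation n := #|X|.
Local Notation state := (state (R := R)).
Local Notation M := (mtr A).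
Local Notation N := (fun c : X => cball c (r + r)%R).
Local Notation rk := (@rk R A).
Local Notation arr := (@arr R A).
Implicit Types (s : state) (Q : state -> Prop) (C D cv : {set X}) (m par pv : X -> X).

(** Stated for single arrays instead of a state, so that writes to other arrays leave it unchanged
    up to conversion. *)
Record base C m D cv k0 (fV fM fC fD fcv : nat -> nat) (v10 : nat) : Prop := Base {
  base_V : arr fV (m @: C);
  base_M : {in C, forall c, fM (rk c) = rk (m c)};
  base_C : arr fC C;
  base_D : arr fD D;
  base_cov : arr fcv cv;
  base_main : v10 = k0 }.

Definition baseS C m D cv k0 s :=
  base C m D cv k0 (nmem s 0) (nmem s 1) (nmem s 2) (nmem s 3) (nmem s 4) (nmem s 10 0).

(* [q] lists the points reached from [u] in the order of the breadth-first search
   for an augmenting path. The triples (point [c] reached, [v] in its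
   neighbourhood, [k] in [C]) are examined in lexicographic order, and [(h, i, j)]
   is the next one; [i'] plays the role of [i] for the test whether [v] can be added. *)
Record bfs C m u q par pv h i i' j : Prop := Bfs {
  bfs_uniq : uniq (u :: q);
  bfs_sub : {subset q <= C};
  bfs_par : {in q, forall k, par k \in u :: q};
  bfs_lev : {in q, forall k, index (par k) (u :: q) < index k (u :: q)};
  bfs_levh : {in q, forall k, index (par k) (u :: q) <= h};
  bfs_pv : {in q, forall k, pv k \in N (par k)};
  bfs_edge : {in q, forall k, edge M (m @: C) (m k) (pv k)};
  bfs_nfree : {in q, forall k, ~~ addable M (m @: C) (pv k)};
  bfs_edges : forall c v k, c \in u :: q -> v \in N c -> k \in C ->
    let l := index c (u :: q) in
    (l < h) || ((l == h) && ((rk v < i) || ((rk v == i) && (rk k < j)))) ->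
    edge M (m @: C) (m k) v ->
    (k \in q) && (index (par k) (u :: q) <= l);
  bfs_nfrees : forall c v, c \in u :: q -> v \in N c ->
    let l := index c (u :: q) in
    (l < h) || ((l == h) && (rk v < i')) -> ~~ addable M (m @: C) v }.

Lemma index_rcons_old (T : eqType) (x y : T) l :
  x \in l -> index x (rcons l y) = index x l.
Proof. by move=> xl; rewrite -cats1 index_cat xl. Qed.

(** [k] enters behind position [h], so [bfs_edges] and [bfs_nfrees] demand nothing of it yet, and
    older positions do not move. *)
Lemma bfs_add C m u q par pv h i i' c k v :
  bfs C m u q par pv h i i' (rk k) -> u \notin C ->
  k \in C -> k \notin q -> c \in u :: q -> index c (u :: q) = h ->
  v \in N c -> edge M (m @: C) (m k) v -> ~~ addable M (m @: C) v ->
  bfs C m u (rcons q k) (reassign par k c) (reassign pv k v) h i i' (rk k).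
Proof.
move=> [bu bs bp bl bh bpv be bnf bes bns] uC kC kq cq ch vN e nf.
have ku : k != u by apply: contraNneq uC => <-.
have kuq : k \notin u :: q by rewrite inE negb_or ku.
have mem x : (x \in u :: rcons q k) = (x == k) || (x \in u :: q).
  by rewrite -rcons_cons mem_rcons inE.
have idx x : x \in u :: q -> index x (u :: rcons q k) = index x (u :: q).
  by rewrite -rcons_cons; apply: index_rcons_old.
have idk : index k (u :: rcons q k) = size (u :: q).
  by rewrite -rcons_cons -cats1 index_cat (negPf kuq) /= eqxx addn0.
have lt_size : h < size (u :: q) by rewrite -ch index_mem.
have rk_ (f : X -> X) y : reassign f k y k = y by rewrite /reassign eqxx.
have rx (f : X -> X) y x : x \in q -> reassign f k y x = f x.
  by rewrite /reassign => xq; case: eqVneq xq => // ->; rewrite (negPf kq).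
have memq x : x \in rcons q k -> x = k \/ x \in q.
  by rewrite mem_rcons inE => /orP[/eqP|]; [left | right].
have qs x : x \in q -> x \in u :: q by rewrite inE orbC => ->.
split.
- by rewrite -rcons_cons rcons_uniq kuq.
- by move=> x /memq[->//|/bs].
- by move=> x /memq[->|xq]; rewrite mem ?rk_ ?rx // ?cq ?bp ?orbT.
- move=> x /memq[->|xq]; first by rewrite rk_ idk idx // ch.
  by rewrite rx // !idx ?bp ?bl ?qs.
- move=> x /memq[->|xq]; first by rewrite rk_ idx // ch.
  by rewrite rx // idx ?bp ?bh.
- by move=> x /memq[->|xq]; rewrite ?rk_ // !rx // bpv.
- by move=> x /memq[->|xq]; rewrite ?rk_ // rx // be.
- by move=> x /memq[->|xq]; rewrite ?rk_ // rx // bnf.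
- move=> c' v' k'; rewrite mem => /orP[/eqP ->|c'q].
    by rewrite idk /= ltnNge (ltnW lt_size) gtn_eqF.
  rewrite idx // => v'N k'C /= D /(bes _ _ _ c'q v'N k'C D)/andP[k'q lek].
  by rewrite mem_rcons inE k'q orbT rx //; have /= -> := idx _ (bp _ k'q).
- move=> c' v'; rewrite mem => /orP[/eqP ->|c'q].
    by rewrite idk /= ltnNge (ltnW lt_size) gtn_eqF.
  by rewrite idx //; apply: bns.
Qed.

(** Queue positions serve as levels. A shortcut from [m k] to [pv k'] would have been examined
    already at the position of [par k'], so [par k] could not come later. *)
Lemma bfs_augpath C m u q par pv h i i' j c v :
  bfs C m u q par pv h i i' j -> matching M N C m -> u \notin C ->
  c \in u :: q -> v \in N c -> addable M (m @: C) v ->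
  augpath M N C m u [set x in q] (index^~ (u :: q)) par pv c v.
Proof.
move=> [bu bs bp bl bh bpv be bnf bes bns] mm uC cq vN fv.
split=> //.
- by apply/subsetP=> x; rewrite inE; apply: bs.
- by move: cq; rewrite !inE.
- by move=> k; rewrite inE => /bp; rewrite !inE.
- by move=> k; rewrite inE; apply: bl.
- by move=> k; rewrite inE; apply: bpv.
- by move=> k; rewrite inE; apply: be.
- by move=> k; rewrite inE; apply: bnf.
- move=> k k'; rewrite !inE => kq k'q lt; apply/negP=> e.
  have lth := leq_trans lt (bh _ kq).
  have := bes _ _ _ (bp _ k'q) (bpv _ k'q) (bs _ kq); rewrite /= lth.
  by move=> /(_ isT e)/andP[_]; rewrite leqNgt lt.
Qed.

(** Past the end of the queue every triple has been examined, so [q] is closed as [closed_rejected]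
    requires. *)
Lemma bfs_rejected C m u q par pv h i i' j :
  bfs C m u q par pv h i i' j -> matching M N C m -> size (u :: q) <= h ->
  rejected M N C u.
Proof.
move=> [bu bs bp bl bh bpv be bnf bes bns] mm le.
have lt c : c \in u :: q -> index c (u :: q) < h.
  by move=> cq; apply: leq_trans le; rewrite index_mem.
apply: (closed_rejected (K := [set x in q]) mm).
  by apply/subsetP=> x; rewrite inE; apply: bs.
move=> c v cq vN; have {}cq : c \in u :: q by move: cq; rewrite !inE.
split; first by apply: (bns c) => //=; rewrite lt.
by move=> k kC /(bes c v k cq vN kC); rewrite inE /= lt // => /(_ isT)/andP[].
Qed.

Lemma bfs_next C m u q par pv h i i' j h2 i2 i2' j2 :
  bfs C m u q par pv h i i' j -> h <= h2 ->
  (forall c v k, c \in u :: q -> v \in N c -> k \in C ->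
    let l := index c (u :: q) in
    (l < h2) || ((l == h2) && ((rk v < i2) || ((rk v == i2) && (rk k < j2)))) ->
    edge M (m @: C) (m k) v ->
    (l < h) || ((l == h) && ((rk v < i) || ((rk v == i) && (rk k < j)))) \/
    (k \in q) && (index (par k) (u :: q) <= l)) ->
  (forall c v, c \in u :: q -> v \in N c ->
    let l := index c (u :: q) in
    (l < h2) || ((l == h2) && (rk v < i2')) -> addable M (m @: C) v ->
    (l < h) || ((l == h) && (rk v < i'))) ->
  bfs C m u q par pv h2 i2 i2' j2.
Proof.
move=> [bu bs bp bl bh bpv be bnf bes bns] le He Hf; split=> //.
- by move=> k kq; apply: leq_trans (bh _ kq) le.
- move=> c v k cq vN kC /= D e; case: (He c v k cq vN kC D e) => // D'.
  exact: bes cq vN kC D' e.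
- move=> c v cq vN /= D; apply/negP=> f.
  by have := bns c v cq vN (Hf c v cq vN D f); rewrite f.
Qed.

Lemma bfs_size C m u q par pv h i i' j :
  bfs C m u q par pv h i i' j -> size (u :: q) <= n.
Proof. by case=> /card_uniqP <- *; apply: max_card. Qed.

Lemma bfs_step C m u q par pv h i' c v k :
  bfs C m u q par pv h (rk v) i' (rk k) -> c \in u :: q -> index c (u :: q) = h ->
  (edge M (m @: C) (m k) v -> k \in C -> k \in q) ->
  bfs C m u q par pv h (rk v) i' (rk k).+1.
Proof.
move=> bf cq ch kq; apply: (bfs_next bf) => // c' v' k' c'q v'N k'C l.
rewrite ltnS [rk k' <= _]leq_eqVlt !andb_orr => /or4P[-> |/andP[-> ->]|/and3P[/eqP lh /eqP/rk_inj Ev /eqP/rk_inj Ek]|].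
- by left.
- by left; rewrite orbT.
- subst k' v' => /kq/(_ k'C) kinq; right.
  by rewrite kinq lh (bfs_levh bf).
- by move=> /and3P[-> -> ->]; left; rewrite !orbT.
Qed.

Record queue u q par pv (fR fQ fP fPv : nat -> nat) (tl : nat) : Prop := Queue {
  queue_R : arr fR [set x in u :: q];
  queue_Q : forall i, i < size (u :: q) -> fQ i = rk (nth u (u :: q) i);
  queue_P : {in q, forall k, fP (rk k) = rk (par k)};
  queue_Pv : {in q, forall k, fPv (rk k) = rk (pv k)};
  queue_tl : tl = size (u :: q) }.

Definition searching C m u c h i i' j s := exists q par pv,
  [/\ bfs C m u q par pv h i i' j,
      queue u q par pv (nmem s 5) (nmem s 6) (nmem s 7) (nmem s 8) (nmem s 22 0),
      nmem s 23 0 = 0 &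
      if c is Some c' then (c' \in u :: q) /\ index c' (u :: q) = h else True].

(** The bound [n] on levels lets [augment] reach the root within its [n] iterations. *)
Definition found C m u s := exists K lev par pv c v,
  [/\ augpath M N C m u K lev par pv c v,
      {in K, forall k, nmem s 7 (rk k) = rk (par k)} /\
      {in K, forall k, nmem s 8 (rk k) = rk (pv k)},
      nmem s 23 0 = 1, nmem s 24 0 = rk c /\ nmem s 25 0 = rk v &
      forall k, k \in u |: K -> lev k <= n].


Definition ctx C m u D cv k0 s := baseS C m D cv k0 s /\ nmem s 21 0 = rk u.

Definition outcome C m u co h i i' j s :=
  found C m u s \/ searching C m u co h i i' j s.

Section Fixed.
Variables (C : {set X}) (m : X -> X) (u : X) (D cv : {set X}) (k0 : nat).
Hypotheses (mm : matching M N C m) (uC : u \notin C).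

Lemma arr_eq0 f S x : arr f S -> (f (rk x) <= 0) = (x \notin S).
Proof. by move=> ->; rewrite leqn0 eqb0. Qed.

Lemma arr_ge1 f S x : arr f S -> (0 < f (rk x)) = (x \in S).
Proof. by move=> ->; rewrite lt0b. Qed.

(** Only [i'] advances: the edges to [v] are scanned afterwards. *)
Lemma run_try_add s Q c v h :
  ctx C m u D cv k0 s -> nmem s 27 0 = rk c -> nmem s 14 0 = rk v -> v \in N c ->
  searching C m u (Some c) h (rk v) (rk v) 0 s ->
  (forall s', ctx C m u D cv k0 s' -> nmem s' 13 0 = nmem s 13 0 ->
    nmem s' 27 0 = rk c -> nmem s' 14 0 = rk v ->
    outcome C m u (Some c) h (rk v) (rk v).+1 0 s' -> Q s') ->
  run A r try_add s Q.
Proof.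
move=> [[bV bM bC bD bcov b0] su] sc sv vN [q [par [pv [bf [qR qQ qP qPv qt] s0 [cq ch]]]]] hQ.
apply: run_if => /=; rewrite sv (arr_eq0 _ bV); last first.
  rewrite negbK => vV; apply: run_skip; apply: hQ => //; right.
  exists q, par, pv; split=> //; apply: (bfs_next bf) => // [*|c' v' c'q v'N /=]; first by left.
  rewrite ltnS [rk v' <= _]leq_eqVlt andb_orr => /or3P[-> //|/andP[_ /eqP/rk_inj ->]|->].
    by rewrite /addable vV.
  by rewrite orbT.
move=> vV; apply: run_seq; apply: run_setN; rewrite /= sv.
have aV : arr (update (nmem s) 0 (rk v) 1 0) (v |: m @: C) by apply: arr_set1.
have bV' : arr (update (update (nmem s) 0 (rk v) 1) 0 (rk v) 0 0) (m @: C).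
  by rewrite -(setU1K vV); apply: arr_set0.
apply: run_seq; apply: run_if; rewrite /= (arr_decode aV) => vI.
  apply: run_seq; apply: run_setN; apply: run_seq; apply: run_setN; apply: run_setN.
  apply: run_setN => /=; rewrite /update /= sv; apply: hQ => //=.
  left.
  exists [set x in q], (index^~ (u :: q)), par, pv, c, v; split=> //.
  + by apply: bfs_augpath bf _ _ _ _ _ => //; apply/andP.
  + by split=> k; rewrite inE; [apply: qP|apply: qPv].
  + by move=> x _; apply: leq_trans (index_size _ _) (bfs_size bf).
apply: run_skip.
apply: run_setN => /=; rewrite /update /= sv; apply: hQ => //=.
right; exists q, par, pv; split=> //; apply: (bfs_next bf) => // [*|c' v' c'q v'N /=]; first by left.
rewrite ltnS [rk v' <= _]leq_eqVlt andb_orr => /or3P[-> //|/andP[_ /eqP/rk_inj ->]|->].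
  by rewrite /addable (negPf vI) andbF.
by rewrite orbT.
Qed.

Lemma run_scan_edge s Q c v h k :
  ctx C m u D cv k0 s -> nmem s 27 0 = rk c -> nmem s 14 0 = rk v -> v \in N c ->
  nmem s 15 0 = rk k -> ~~ addable M (m @: C) v ->
  searching C m u (Some c) h (rk v) (rk v).+1 (rk k) s ->
  (forall s', ctx C m u D cv k0 s' -> nmem s' 13 0 = nmem s 13 0 ->
    nmem s' 27 0 = rk c -> nmem s' 14 0 = rk v -> nmem s' 15 0 = rk k ->
    searching C m u (Some c) h (rk v) (rk v).+1 (rk k).+1 s' -> Q s') ->
  run A r scan_edge s Q.
Proof.
move=> [[bV bM bC bD bcov b0] su] sc sv vN sk nf.
move=> [q [par [pv [bf [qR qQ qP qPv qt] s0 [cq ch]]]]] hQ.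
apply: run_if => /=; rewrite sk (arr_ge1 _ bC) (arr_eq0 _ qR) !inE; last first.
  move=> g; apply: run_skip; apply: hQ => //.
  exists q, par, pv; split=> //; apply: (bfs_step bf cq ch) => _ kC.
  move: g; rewrite kC /= negbK => /orP[/eqP ku|//].
  by case/negP: (uC); rewrite -ku.
case/andP=> kC; rewrite negb_or => /andP[ku kq].
have wV : m k \in m @: C by apply: imset_f.
apply: run_seq; apply: run_setN; apply: run_seq; apply: run_setN; apply: run_seq.
rewrite /update /= sk (bM _ kC).
have aV := arr_set0 (m k) bV.
have rV : arr (fun j => if j == rk (m k) then 1 else if j == rk (m k) then 0 else nmem s 0 j) (m @: C).
  by rewrite -(setD1K wV); apply: arr_set1.
apply: run_if => /=; rewrite /update /= sv (arr_eq0 _ aV); last first.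
  rewrite negbK => vV; apply: run_skip; apply: run_setN; rewrite /= /update /=.
  apply: hQ => //=; exists q, par, pv; split=> //; apply: (bfs_step bf cq ch).
  by rewrite /edge vV.
move=> vV; apply: run_seq; apply: run_setN; rewrite /= /update /= sv.
have aV' := arr_set1 v aV.
have rV' := arr_set1 (m k) (arr_set0 v aV'); rewrite setU1K // setD1K // in rV'.
apply: run_seq; apply: run_if; rewrite /= (arr_decode aV') => vI.
  do 4! (apply: run_seq; apply: run_setN; rewrite /= /update /= ?sk ?sc ?sv ?qt).
  apply: run_setN; rewrite /= /update /= ?sk ?sc ?sv ?qt.
  apply: run_setN; rewrite /= /update /= ?sk ?sc ?sv ?qt.
  apply: run_setN; rewrite /= /update /= ?sk ?sc ?sv ?qt.
  apply: hQ => //=.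
  exists (rcons q k), (reassign par k c), (reassign pv k v); split=> //; last first.
    rewrite -rcons_cons mem_rcons inE cq orbT; split=> //.
    by rewrite index_rcons_old.
    have kuq : k \notin u :: q by rewrite inE negb_or ku.
    split.
    - move=> x; rewrite /= /update /= (arr_set1 k qR) !inE mem_rcons !inE.
      by rewrite orbCA.
    - move=> i; rewrite -rcons_cons size_rcons ltnS leq_eqVlt nth_rcons.
      case/orP=> [/eqP ->|lt]; first by rewrite ltnn eqxx /= /update /= eqxx.
      by rewrite lt /= /update /= ltn_eqF // qQ.
    - move=> x; rewrite mem_rcons inE /reassign /= /update /= rk_eq.
      by case: eqVneq => // _; apply: qP.
    - move=> x; rewrite mem_rcons inE /reassign /= /update /= rk_eq.
      by case: eqVneq => // _; apply: qPv.
    - by rewrite /= /update /= size_rcons addn1.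
  apply: (bfs_step (c := c)).
  - by apply: bfs_add bf _ _ _ cq ch vN _ nf => //; apply/andP.
  - by rewrite -rcons_cons mem_rcons inE cq orbT.
  - by rewrite -rcons_cons index_rcons_old.
  - by rewrite mem_rcons mem_head.
apply: run_skip.
do 2! (apply: run_setN; rewrite /= /update /= ?sk ?sc ?sv).
apply: hQ => //=.
exists q, par, pv; split=> //; apply: (bfs_step bf cq ch).
by rewrite /edge (negPf vI) andbF.
Qed.

Lemma dist_leE x y t : (dist_input A (rk x) (rk y) <= t)%R = (y \in cball x t).
Proof. by rewrite dist_inputE inE. Qed.

Lemma found_flag s : found C m u s -> nmem s 23 0 = 1.
Proof. by case=> [K [lev [par [pv [c [v []]]]]]]. Qed.

Lemma searching_flag co h i i' j s :
  searching C m u co h i i' j s -> nmem s 23 0 = 0.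
Proof. by case=> [q [par [pv []]]]. Qed.

Lemma run_scan_point s Q c v h :
  ctx C m u D cv k0 s -> nmem s 27 0 = rk c -> nmem s 14 0 = rk v ->
  outcome C m u (Some c) h (rk v) (rk v) 0 s ->
  (forall s', ctx C m u D cv k0 s' -> nmem s' 13 0 = nmem s 13 0 ->
    nmem s' 27 0 = rk c -> nmem s' 14 0 = rk v ->
    outcome C m u (Some c) h (rk v).+1 (rk v).+1 0 s' -> Q s') ->
  run A r scan_point s Q.
Proof.
move=> cs sc sv out hQ; apply: run_if => /=; rewrite sc sv dist_leE; last first.
  move=> g; apply: run_skip; apply: hQ => //.
  case: out => [f|]; first by left.
  move=> [q [par [pv [bf qu s0 [cq ch]]]]]; right; exists q, par, pv; split=> //.
  move: g; rewrite s0 /= => vN.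
  (* Only [c] has position [h], and [v] is outside its neighbourhood, so no triple there involves
     [v]. *)
  have ne c' v' : c' \in u :: q -> v' \in N c' -> index c' (u :: q) = h -> v' != v.
    move=> c'q v'N E; apply: contraNneq vN => <-.
    by rewrite -(nth_index u cq) ch -E nth_index.
  apply: (bfs_next bf) => // c' v' => [k' c'q v'N _|c'q v'N] l.
    case/orP=> [->|/andP[/eqP E]]; first by left.
    rewrite ltn0 andbF orbF ltnS leq_eqVlt rk_eq (negPf (ne _ _ c'q v'N E)) /=.
    by move=> ->; left; rewrite E eqxx orbT.
  case/orP=> [->//|/andP[/eqP E]].
  rewrite ltnS leq_eqVlt rk_eq (negPf (ne _ _ c'q v'N E)) /=.
  by move=> ->; rewrite E eqxx orbT.
case/andP=> flag vN; apply: run_seq.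
case: out => [/found_flag f|se]; first by rewrite f in flag.
apply: (run_try_add cs sc sv vN se) => s1 cs1 s113 s1c s1v out.
apply: run_if => /=; last first.
  move=> g; apply: run_skip; apply: hQ => //.
  case: out => [f|/searching_flag f]; first by left.
  by rewrite f in g.
move=> flag1; case: out => [/found_flag f|se1]; first by rewrite f in flag1.
have nf : ~~ addable M (m @: C) v.
  case: se1 => [q [par [pv [bf _ _ [cq ch]]]]].
  by apply: (bfs_nfrees bf cq vN); rewrite ch eqxx ltnS leqnn orbT.
pose I j s' := [/\ ctx C m u D cv k0 s', nmem s' 13 0 = nmem s 13 0,
  nmem s' 27 0 = rk c, nmem s' 14 0 = rk v &
  searching C m u (Some c) h (rk v) (rk v).+1 j s'].
apply: (run_for_points (I := I)).
- by split.
- move=> k s2 s2k [cs2 s213 s2c s2v se2].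
  apply: run_scan_edge cs2 s2c s2v vN s2k nf se2 _ => s3 cs3 s313 s3c s3v s3k se3.
  by split=> //; split=> //; rewrite -s213.
- move=> s2 [cs2 s213 s2c s2v se2]; apply: hQ => //; right.
  case: se2 => [q [par [pv [bf qu s20 cc]]]]; exists q, par, pv; split=> //.
  (* All point numbers being below [n], the scan position [(rk v, n)] amounts to
     [((rk v).+1, 0)]. *)
  apply: (bfs_next bf) => // c' v' k' _ _ _ l.
  rewrite ltn0 andbF orbF ltnS [rk v' <= _]leq_eqVlt => D' _; left.
  by rewrite rk_lt andbT [X in _ && X]orbC.
Qed.

Lemma run_search s Q :
  baseS C m D cv k0 s -> nmem s 21 0 = rk u ->
  (forall s', ctx C m u D cv k0 s' ->
    found C m u s' \/ nmem s' 23 0 = 0 /\ rejected M N C u -> Q s') ->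
  run A r search s Q.
Proof.
move=> bs su hQ; apply: run_seq.
pose I1 j s' := ctx C m u D cv k0 s' /\ forall x, rk x < j -> nmem s' 5 (rk x) = 0.
apply: (run_for_points (I := I1)) => //.
  move=> x s1 s1x [cs1 s15]; apply: run_setN; split=> //; split=> //.
  move=> y; rewrite /= /update /= s1x rk_eq ltnS leq_eqVlt rk_eq.
  by case: eqVneq => //= _; apply: s15.
move=> s1 [[bs1 s1u] s15].
have R0 : arr (nmem s1 5) set0 by move=> x; rewrite inE s15 ?rk_lt.
do 4! (apply: run_seq; apply: run_setN; rewrite /= /update /= ?s1u).
pose I2 h s' := ctx C m u D cv k0 s' /\ outcome C m u None h 0 0 0 s'.
apply: (run_for (I := I2)).
- split=> //; right; exists [::], id, id; split=> //; split=> //=.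
  + by move=> c v k _ _ _; rewrite ltn0 !andbF.
  + by move=> c v _ _; rewrite ltn0 andbF.
  + move=> x; by rewrite /= /update /= (arr_set1 u R0) !inE orbF.
  + by case.
- move=> h s2 hn s2h [cs2 out]; apply: run_if => /=; rewrite s2h addn1; last first.
    move=> g; apply: run_skip; split=> //; split=> //.
    case: out => [f|[q [par [pv [bf qu flag _]]]]]; [by left | right].
    exists q, par, pv; split=> //.
    move: g; rewrite flag /= andbT (queue_tl qu) -leqNgt => le.
    (* With the queue exhausted, all its positions precede [h], so advancing [h] examines nothing
       new. *)
    have lt c : c \in u :: q -> index c (u :: q) < h.
      by move=> cq; apply: leq_trans le; rewrite index_mem.
    by apply: (bfs_next bf) => // c v => [k cq|cq] *; [left|]; rewrite lt.
  case/andP=> lt flag.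
  case: out => [/found_flag f|[q [par [pv [bf qu _ _]]]]]; first by rewrite f in flag.
  rewrite (queue_tl qu) in lt; pose c := nth u (u :: q) h.
  have cq : c \in u :: q by apply: mem_nth.
  have ch : index c (u :: q) = h by apply: index_uniq => //; apply: bfs_uniq bf.
  apply: run_seq; apply: run_setN; rewrite /= s2h (queue_Q qu lt).
  pose I3 i s' := [/\ ctx C m u D cv k0 s', nmem s' 13 0 = h, nmem s' 27 0 = rk c &
    outcome C m u (Some c) h i i 0 s'].
  apply: (run_for_points (I := I3)).
  + split=> //; right; exists q, par, pv; split=> //.
    by apply/eqP; rewrite -leqn0.
  + move=> v s3 s3v [cs3 s3h s3c out3].
    apply: run_scan_point cs3 s3c s3v out3 _ => s4 cs4 s4h s4c s4v out4.
    by split=> //; split=> //; rewrite -s3h.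
  + move=> s3 [cs3 s3h s3c out3]; split=> //; split=> //.
    case: out3 => [f|[q' [par' [pv' [bf' qu' flag' _]]]]]; [by left | right].
    exists q', par', pv'; split=> //; apply: (bfs_next bf') => // c' v'.
      move=> k' _ _ _ l; rewrite !ltn0 !andbF orbF ltnS leq_eqVlt rk_lt => D' _.
      by left; rewrite orbC andbT.
    by move=> _ _ l; rewrite ltn0 andbF orbF ltnS leq_eqVlt rk_lt orbC andbT.
- move=> s2 [cs2 out]; apply: hQ => //.
  case: out => [f|[q [par [pv [bf qu flag _]]]]]; [by left | right].
  (* The queue has distinct members, so position [n] is past its end. *)
  by split=> //; apply: bfs_rejected bf mm (bfs_size bf).
Qed.

End Fixed.

End Search.

(** * Augmentation, covering, selection and the main loop *)

(** Iterations left after reaching the root are idle. Variable 25 is updated before 24, whose old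
    value it reads. *)
Definition augment : cmd :=
  for_points 16
    (CIf (BAnd (BLeN (var 24) (var 21)) (BLeN (var 21) (var 24))) CSkip
       (CSetN 0 (NGet 1 (var 24)) 0;; CSetN 0 (var 25) 1;;
        CSetN 1 (var 24) (var 25);; setvar 25 (NGet 8 (var 24));;
        setvar 24 (NGet 7 (var 24))));;
  CSetN 0 (var 25) 1;; CSetN 1 (var 21) (var 25);; CSetN 2 (var 21) 1.

Definition cover : cmd :=
  for_points 11
    (CIf (BLeR (RDist (var 21) (var 11)) (RAdd (RAdd RRadius RRadius) RRadius))
       (CSetN 4 (var 11) 1) CSkip).

Definition select : cmd :=
  setvar 20 0;;
  for_points 11
    (CIf (BLeN (NGet 3 (var 11)) 0)
       (CSetR 0 0 RZero;;
        for_points 12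
          (CIf (BAnd (BLeN (NGet 4 (var 12)) 0)
                     (BLeR (RDist (var 11) (var 12)) RRadius))
             (CSetR 0 0 (RAdd (RGet 0 0) (RWeight (var 12)))) CSkip);;
        CIf (BAnd (BLeN 1 (var 20)) (BLeR (RGet 0 0) (RGet 1 0))) CSkip
          (setvar 20 1;; setvar 21 (var 11);; CSetR 1 0 (RGet 0 0)))
       CSkip).

Definition robust_matroid_center : cmd :=
  for_points 10
    (select;;
     CIf (BLeN 1 (var 20))
       (CSetN 3 (var 21) 1;; search;;
        CIf (BLeN 1 (var 23)) (augment;; cover) CSkip)
       CSkip).

(** * Correctness of the algorithm *)

Section Main.
Context {R : realType} (A : rmc_instance R) (r : R).
Local Notation X := (points A).
Local Notation n := #|X|.
Local Notation state := (state (R := R)).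
Local Notation M := (mtr A).
Local Notation N := (fun c : X => cball c (r + r)%R).
Local Notation rk := (@rk R A).
Local Notation arr := (@arr R A).
Local Notation wt := (@wt R A).
Implicit Types (s : state) (Q : state -> Prop) (C D cv : {set X}) (m par pv : X -> X).

Lemma run_augment C m u D cv k0 s Q :
  ctx C m u D cv k0 s -> found r C m u s ->
  (forall s' m', baseS (u |: C) m' D cv k0 s' -> nmem s' 21 0 = rk u ->
    matching M N (u |: C) m' -> Q s') ->
  run A r augment s Q.
Proof.
move=> cs fs hQ; apply: run_seq.
pose I k s' := exists m' K lev par pv c v,
  [/\ augpath M N C m' u K lev par pv c v, ctx C m' u D cv k0 s',
      {in K, forall k, nmem s' 7 (rk k) = rk (par k)} /\
      {in K, forall k, nmem s' 8 (rk k) = rk (pv k)},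
      nmem s' 24 0 = rk c /\ nmem s' 25 0 = rk v &
      (c == u) || (lev c <= n - k)].
apply: (run_for (I := I)).
- case: fs => [K [lev [par [pv [c [v [ap mem _ cur le]]]]]]].
  exists m, K, lev, par, pv, c, v; split=> //.
  by rewrite subn0 le ?orbT //; apply: ap_cur ap.
- move=> k s1 kn s1k [m1 [K [lev [par [pv [c [v [ap [bs s1u] [mP mPv] [sc sv] le]]]]]]]].
  apply: run_if => /=; rewrite sc s1u -eqn_leq rk_eq => cu.
    apply: run_skip; split=> //; exists m1, K, lev, par, pv, c, v; split=> //.
    by rewrite cu.
  have cK : c \in K by have := ap_cur ap; rewrite in_setU1 (negPf cu).
  have cC : c \in C by apply: (subsetP (ap_sub ap)).
  have [bV bM bC bD bcov b0] := bs.
  have ap' := augpath_step cu ap.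
  have [_ mi _] := ap_matching ap.
  do 4! (apply: run_seq; apply: run_setN; rewrite /= /update /= ?sc ?sv ?(bM _ cC)).
  apply: run_setN; rewrite /= /update /= ?sc ?sv.
  split=> //; exists (reassign m1 c v), [set k in K | lev k <= lev (par c)].
  exists lev, par, pv, (par c), (pv c); split=> //.
  + split=> //; split=> //.
      by rewrite reassign_imset //; apply: arr_set1; apply: arr_set0.
    move=> d dC; rewrite /= /update /= rk_eq /reassign.
    by case: eqVneq => // _; apply: bM.
  + split=> d; rewrite inE => /andP[dK _]; [exact: mP | exact: mPv].
  + by rewrite /= /update /= mP // mPv.
  + move: le; rewrite (negPf cu) /= => le; apply/orP; right.
    rewrite subnS -ltnS; apply: leq_trans (ap_lev ap cK) _.
    by rewrite prednK // subn_gt0.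
- move=> s1 [m1 [K [lev [par [pv [c [v [ap [bs s1u] _ [sc sv] le]]]]]]]].
  (* The level is now 0, but members of [K] lie strictly above their predecessors. *)
  have Ec : c = u.
    apply/eqP; case/orP: le => //; rewrite subnn leqn0 => /eqP l0.
    have := ap_cur ap; rewrite in_setU1 => /orP[//|cK].
    by have := ap_lev ap cK; rewrite l0.
  have [bV bM bC bD bcov b0] := bs.
  have uC := ap_root ap.
  have [E mm'] : reassign m1 u v @: (u |: C) = v |: m1 @: C /\
     matching M N (u |: C) (reassign m1 u v).
    by rewrite Ec in ap; apply: augpath_end ap.
  do 2! (apply: run_seq; apply: run_setN; rewrite /= /update /= ?sv ?s1u).
  apply: run_setN; rewrite /= /update /= ?s1u.
  apply: (hQ _ (reassign m1 u v)) => //; split=> //.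
  + by rewrite E; apply: arr_set1.
  + move=> d; rewrite in_setU1 /= /update /= rk_eq /reassign.
    by case: eqVneq => // _; apply: bM.
  + exact: arr_set1.
Qed.

Lemma run_cover C m u D cv k0 s Q :
  baseS C m D cv k0 s -> nmem s 21 0 = rk u ->
  (forall s', baseS C m D (cball u (r + r + r)%R :|: cv) k0 s' -> Q s') ->
  run A r cover s Q.
Proof.
move=> [bV bM bC bD bcov b0] su hQ.
pose I j s' := [/\ baseS C m D (cv :|: [set x | (rk x < j) & (x \in cball u (r + r + r)%R)]) k0 s' &
   nmem s' 21 0 = rk u].
apply: (run_for_points (I := I)).
- split=> //; split=> //=.
  by move=> x; rewrite !inE orbF; apply: bcov.
- move=> x s1 s1x [[cV cM cC cD ccov c0] s1u].
  apply: run_if => /=; rewrite s1u s1x dist_leE => g.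
    apply: run_setN; rewrite /= s1x; split=> //; split=> //; split=> //.
    move=> y; rewrite /= /update /= rk_eq in_setU inE ltnS [rk y <= _]leq_eqVlt rk_eq.
    case: eqVneq => [->|_] /=; first by rewrite g orbT.
    by rewrite ccov !inE.
  apply: run_skip; split=> //; split=> //; split=> //.
  move=> y; rewrite /= /update /= ccov !inE ltnS [rk y <= _]leq_eqVlt rk_eq.
  case: eqVneq => [->|_] //=.
  by move: g; rewrite inE => /negPf ->; rewrite andbF.
- move=> s1 [bs _]; apply: hQ; congr (baseS _ _ _ _ _ _): bs.
  by apply/setP=> x; rewrite !inE rk_lt orbC.
Qed.

Lemma run_select C m D cv k0 s Q :
  baseS C m D cv k0 s ->
  (forall s', baseS C m D cv k0 s' ->
    nmem s' 20 0 = 0 /\ D = setT \/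
    nmem s' 20 0 = 1 /\ (exists u, [/\ nmem s' 21 0 = rk u, u \notin D &
      forall x, x \notin D ->
       (weight wt (cball x r :\: cv) <= weight wt (cball u r :\: cv))%R]) -> Q s') ->
  run A r select s Q.
Proof.
move=> bs hQ; pose g x := weight wt (cball x r :\: cv).
apply: run_seq; apply: run_setN; rewrite /=.
pose I i s' := baseS C m D cv k0 s' /\
  (nmem s' 20 0 = 0 /\ (forall x, rk x < i -> x \in D) \/
   nmem s' 20 0 = 1 /\ (exists u, [/\ nmem s' 21 0 = rk u, u \notin D,
      rmem s' 1 0 = g u & forall x, rk x < i -> x \notin D -> (g x <= g u)%R])).
apply: (run_for_points (I := I)).
- by split=> //; left.
- move=> x s1 s1x [bs1 best]; apply: run_if => /=; rewrite s1x (arr_eq0 _ (base_D bs1)); last first.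
    rewrite negbK => xD; apply: run_skip; split=> //; split=> //.
    case: best => [[f h]|[f [u [su uD vu h]]]]; [left | right]; split=> //.
      by move=> y; rewrite ltnS leq_eqVlt rk_eq => /orP[/eqP ->|/h].
    exists u; split=> // y; rewrite ltnS leq_eqVlt rk_eq => /orP[/eqP ->|/h //].
    by rewrite xD.
  move=> xD; apply: run_seq; apply: run_setR => /=; apply: run_seq.
  pose best' s' := nmem s' 20 0 = 0 /\ (forall x', rk x' < rk x -> x' \in D) \/
   nmem s' 20 0 = 1 /\ (exists u, [/\ nmem s' 21 0 = rk u, u \notin D,
      rmem s' 1 0 = g u & forall x', rk x' < rk x -> x' \notin D -> (g x' <= g u)%R]).
  pose J j s' := [/\ baseS C m D cv k0 s', nmem s' 11 0 = rk x, best' s' &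
    rmem s' 0 0 = (\sum_(y in cball x r :\: cv | (rk y < j)%N) wt y)%R].
  apply: (run_for_points (I := J)).
  + by split=> //=; rewrite big_pred0 // => y; rewrite ltn0 andbF.
  + move=> y s2 s2y [bs2 s2x b2 sum].
    apply: run_if => /=; rewrite s2x s2y dist_leE (arr_eq0 _ (base_cov bs2)).
      move=> yc; apply: run_setR; rewrite /= s2y; split=> //; split=> //=.
      rewrite /update /= sum weight_inputE [RHS](bigD1 y) /=; last first.
        by rewrite in_setD yc ltnS leqnn.
      rewrite addrC; congr (_ + _)%R; apply: eq_bigl => z.
      rewrite ltnS [rk z <= _]leq_eqVlt rk_eq -andbA; congr (_ && _).
      by case: eqVneq => [->|_]; rewrite ?ltnn ?andbF ?andbT.
    move=> yc; apply: run_skip; split=> //; split=> //=; rewrite sum.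
    apply: eq_bigl => z; rewrite ltnS [rk z <= _]leq_eqVlt rk_eq in_setD.
    by case: eqVneq => [->|_] //=; rewrite (negPf yc).
  + move=> s2 [bs2 s2x b2 sum].
    have {}sum : rmem s2 0 0 = g x.
      by rewrite sum; apply: eq_bigl => z; rewrite rk_lt andbT.
    apply: run_if => /=; rewrite sum.
      case/andP=> flag le; apply: run_skip; split=> //; split=> //; right.
      case: b2 => [[f _]|[f [u [su uD vu h]]]]; first by rewrite f in flag.
      split=> //; exists u; split=> // y.
      rewrite ltnS leq_eqVlt rk_eq => /orP[/eqP -> _|]; last exact: h.
      by rewrite -vu.
    move=> nle; do 2! (apply: run_seq; apply: run_setN; rewrite /= /update /= ?s2x).
    apply: run_setR; rewrite /= /update /= sum; split=> //; split=> //; right.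
    split=> //; exists x; split=> // y.
    rewrite ltnS leq_eqVlt rk_eq => /orP[/eqP -> _|lt yD]; first exact: lexx.
    case: b2 => [[f h]|[f [u [su uD vu h]]]]; first by rewrite h in yD.
    apply: le_trans (h _ lt yD) _; move: nle; rewrite f vu /= -ltNge.
    exact: ltW.
- move=> s1 [bs1 best]; apply: hQ => //.
  case: best => [[f h]|[f [u [su uD _ h]]]]; [left | right]; split=> //.
    by apply/setP=> x; rewrite h ?inE // rk_lt.
  by exists u; split=> // x; apply: h; apply: rk_lt.
Qed.

Lemma run_main s Q : (0 <= r)%R ->
  @baseS R A set0 id set0 set0 0 s ->
  (forall s' us m, greedy wt M r us -> matching M N [set x in us] m ->
     (forall x, x \in us \/ rejected M N [set x in us] x) ->
     arr (nmem s' 0) (m @: [set x in us]) -> Q s') ->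
  run A r robust_matroid_center s Q.
Proof.
move=> r0 bs hQ.
(* Each round considers a new point unless none is left, whence [k <= #|D|]; after [n] rounds [D] is
   everything. *)
pose I k s' := exists us m D,
  [/\ greedy wt M r us, matching M N [set x in us] m,
    base [set x in us] m D (cov r us) k (nmem s' 0) (nmem s' 1) (nmem s' 2)
      (nmem s' 3) (nmem s' 4) k,
    k <= #|D| & [set x in us] \subset D /\
      {in D, forall x, x \in us \/ rejected M N [set x in us] x}].
have set0us : [set x in [::]] = set0 :> {set X} by apply/setP=> x; rewrite !inE.
apply: (run_for (I := I)).
- exists [::], id, set0; split=> //.
  + split=> [c|c d|]; rewrite ?set0us ?inE ?imset0 ?indep0 //.
  + case: bs => bV bM bC bD bcov _.
    by rewrite set0us /cov big_nil; split.
  + by rewrite set0us sub0set; split=> // x; rewrite inE.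
- move=> k s1 kn s1k [us [m [D [gr mm [bV bM bC bD bcov _] kD [usD all]]]]].
  have {bV bM bC bD bcov}bs1 : baseS [set x in us] m D (cov r us) k s1 by split.
  apply: run_seq; apply: run_select bs1 _ => s2 bs2 best.
  apply: run_if => /=; last first.
    (* Nothing was selected, so [D] is already full and the bound holds without progress. *)
    case: best => [[f DT]|[f _]]; last by rewrite f.
    move=> _; apply: run_skip; split; first exact: base_main bs2.
    exists us, m, D; split=> //; last by rewrite DT cardsT.
    by case: bs2 => bV bM bC bD bcov _; split.
  case: best => [[-> _]//|[_ [u [su uD ug]]]] _.
  apply: run_seq; apply: run_setN; rewrite /= su; apply: run_seq.
  set s3 := setn _ _ _ _.
  have uus : u \notin us.
    by apply: contra uD => uus; apply: (subsetP usD); rewrite inE.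
  have bs3 : baseS [set x in us] m (u |: D) (cov r us) k s3.
    by case: bs2 => bV bM bC bD bcov b0; split=> //; apply: arr_set1.
  have kD' : k < #|u |: D| by rewrite cardsU1 uD ltnS.
  apply: run_search bs3 su _ => //; first by rewrite inE.
  move=> s4 [bs4 s4u] out.
  apply: run_if => /=; last first.
    case: out => [/found_flag ->//|[_ rej]] _; apply: run_skip.
    split; first exact: base_main bs4.
    exists us, m, (u |: D); split=> //.
      by case: bs4 => bV bM bC bD bcov _; split.
    split; first by rewrite (subset_trans usD) // subsetUr.
    by move=> x; rewrite in_setU1 => /orP[/eqP ->|/all]; [right|].
  case: out => [fs|[-> //]] _; apply: run_seq.
  have usU : [set x in u :: us] = u |: [set x in us] by apply/setP=> x; rewrite !inE.
  apply: run_augment (conj bs4 s4u) fs _ => s5 m5 bs5 s5u mm5.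
  apply: run_cover bs5 s5u _ => s6 bs6.
  split; first exact: base_main bs6.
  exists (u :: us), m5, (u |: D); rewrite usU; split=> //.
  (* An earlier [x] has gain 0 or is rejected; any other was eligible when [u] was selected. *)
  + split=> // x; case: (boolP (x \in D)) => [/all[xus|]|xD]; [|by left|].
      by right; rewrite (gain_mem wt r0 xus) weight_ge0 // => y; apply: wt_ge0.
    by right; apply: ug.
  + by rewrite cov_cons; case: bs6 => bV bM bC bD bcov _; split.
  + split; first exact: setUS.
    move=> x; rewrite in_setU1 inE => /orP[->|/all[->|rej]]; [by left| |right].
      by left; rewrite orbT.
    (* Certificates survive the growth of the set of centers. *)
    by apply: rejected_sub rej; apply: subsetUr.
- move=> s1 [us [m [D [gr mm bs1 nD [usD all]]]]].
  apply: (hQ _ us m) => //; last exact: base_V bs1.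
  have DT : D = setT by apply/eqP; rewrite eqEcard subsetT cardsT.
  by move=> x; apply: all; rewrite DT inE.
Qed.

End Main.

Local Open Scope ring_scope.

Theorem theorem2 :
  exists (P : cmd) (p : {poly nat}),
  forall (R : realType) (A : rmc_instance R) (r : R), 0 <= r ->
  exists (t : nat) (s : state (R := R)),
    [/\ exec A r P init_state t s,
        (t <= p.[#|points A|])%N
      & (exists F : {set points A}, rmc_solution r F) ->
        rmc_solution (5%:R * r) (output A s)].
Proof.
exists robust_matroid_center, (cost robust_matroid_center) => R A r r0.
suff [t [s [e l sol]]] : run A r robust_matroid_center init_state
    (fun s => (exists F : {set points A}, rmc_solution r F) ->
        rmc_solution (5%:R * r) (output A s)) by exists t, s.
apply: run_main => //.
  by split=> // x; rewrite ?imset0 inE.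
move=> s us m gr mm compl aV [F [FI Fw]].
have [_ _ mI] := mm.
rewrite /output (arr_decode aV); split=> //.
apply: le_trans Fw _.
have w0 := @wt_ge0 R A.
apply: le_trans (greedy_cover w0 r0 FI gr mm compl) _.
by apply: weight_sub => //; apply: cov_sub mm.
Qed.
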